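(* There is a universal constant $K$ such that every connected edge-weighted graph $G=(V,E,w)$ on $n\ge 2$ vertices with pathwidth $\mathrm{pw}$, and with minimum pairwise distance $1$, admits a $\gamma$-hierarchy of strong $(\alpha,\tau)$-sparse partitions for some $\alpha\le K\,\mathrm{pw}$, $\tau\le K\,\mathrm{pw}^2$ and $\gamma\le K\,\mathrm{pw}^2$.
   Context: Graphs are finite and undirected with positive edge weights; $d_G$ is the shortest-path distance, $B_G(v,r)=\{u: d_G(u,v)\le r\}$, and $G[C]$ is the subgraph induced by $C\subseteq V$. It is assumed (by scaling) that the minimum distance between distinct vertices of $G$ is $1$. A strong $\Delta$-diameter $(\alpha,\tau)$-sparse partition of $G$ is a partition $\mathcal C$ of $V$ such that: (1) for every $C\in\mathcal C$ the induced graph $G[C]$ has diameter at most $\Delta$ (distances measured in $G[C]$); (2) for every $v\in V$, the ball $B_G(v,\Delta/\alpha)$ intersects at most $\tau$ clusters of $\mathcal C$. A $\gamma$-hierarchy of strong $(\alpha,\tau)$-sparse partitions consists of partitions $\{\{v\}:v\in V\}=\mathcal C_0,\mathcal C_1,\dots,\mathcal C_k=\{V\}$ of $V$ such that: (1) $\mathcal C_i$ is a strong $\gamma^i$-diameter $(\alpha,\tau)$-sparse partition for every $i$; (2) $\mathcal C_{i+1}$ coarsens $\mathcal C_i$, i.e. each $U\in\mathcal C_i$ is contained in some $U'\in\mathcal C_{i+1}$. A path decomposition of $G$ is a path with nodes (bags) $X_1,\dots,X_s\subseteq V$ such that every edge of $G$ is contained in some bag and, for every vertex $v$, the bags containing $v$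 form a connected subpath. Its width is $\max_i(|X_i|-1)$, and the pathwidth of $G$ is the minimum width of a path decomposition of $G$. *)

(* Defs.v *)
From HB Require Import structures.
From mathcomp Require Import all_boot all_order all_algebra.
From mathcomp Require Import boolp classical_sets reals constructive_ereal ereal.

Set Implicit Arguments.
Unset Strict Implicit.
Unset Printing Implicit Defensive.

Import Order.TTheory GRing.Theory Num.Theory.

Local Open Scope ring_scope.

Record wgraph (R : realType) (V : finType) := WGraph {
  adj : rel V;
  wt : V -> V -> R;
  adj_sym : symmetric adj;
  adj_irr : irreflexive adj;
  wt_sym : forall u v, wt u v = wt v u;
  wt_pos : forall u v, adj u v -> 0 < wt u v }.

Definition connected_graph (R : realType) (V : finType) (G : wgraph R V) : Prop :=
  forall u v, connect (adj G) u v.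

Section Distance.
Variables (R : realType) (V : finType) (G : wgraph R V).

Definition walk_length (u : V) (p : seq V) : R :=
  \sum_(c <- pairmap (wt G) u p) c.

(* The infimum is attained, by a simple path, as soon as u and v are
   connected; otherwise it is +oo. *)
Definition dist (u v : V) : \bar R :=
  ereal_inf [set (walk_length u p)%:E |
               p in [set p | path (adj G) u p /\ last u p = v]]%classic.

Definition diameter : \bar R :=
  ereal_sup [set dist uv.1 uv.2 | uv in [set: V * V]]%classic.

Definition ball (v : V) (r : R) : {set V} :=
  [set u | (dist u v <= r%:E)%E].

End Distance.

Section Induced.
Variables (R : realType) (V : finType) (G : wgraph R V) (C : {set V}).

Let W := {x : V | x \in C}.

Lemma induced_sym : symmetric (fun x y : W => adj G (val x) (val y)).
Proof. by move=> x y; rewrite adj_sym. Qed.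

Lemma induced_irr : irreflexive (fun x y : W => adj G (val x) (val y)).
Proof. by move=> x; rewrite adj_irr. Qed.

Definition induced : wgraph R W :=
  {| adj := fun x y => adj G (val x) (val y);
     wt := fun x y => wt G (val x) (val y);
     adj_sym := induced_sym;
     adj_irr := induced_irr;
     wt_sym := fun x y => wt_sym G (val x) (val y);
     wt_pos := fun x y => @wt_pos R V G (val x) (val y) |}.

End Induced.

Section SparsePartition.
Variables (R : realType) (V : finType) (G : wgraph R V).

(* alpha must be positive for the radius Delta / alpha to make sense: for
   alpha < 0 the balls would be empty, and x / 0 = 0 in MathComp. *)
Definition strong_sparse_partition (Delta alpha : R) (tau : nat)
    (P : {set {set V}}) : Prop :=
  [/\ 0 < alpha,
      finset.partition P [set: V],
      forall C, C \in P -> (diameter (induced G C) <= Delta%:E)%E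
    & forall v : V,
        (#|[set C in P | C :&: ball G v (Delta / alpha) != finset.set0]| <= tau)%N].

Definition coarsens (P Q : {set {set V}}) : Prop :=
  forall U, U \in P -> exists2 U', U' \in Q & U \subset U'.

Definition sparse_hierarchy (gamma alpha : R) (tau k : nat)
    (C : nat -> {set {set V}}) : Prop :=
  [/\ C 0%N = [set [set v] | v : V],
      C k = [set [set: V]],
      forall i, (i <= k)%N -> strong_sparse_partition (gamma ^+ i) alpha tau (C i)
    & forall i, (i < k)%N -> coarsens (C i) (C i.+1)].

End SparsePartition.

Section Pathwidth.
Variables (R : realType) (V : finType) (G : wgraph R V).

Definition path_decomposition (X : seq {set V}) : Prop :=
  [/\ forall v, exists2 B, B \in X & v \in B,
      forall u v, adj G u v -> exists2 B, B \in X & (u \in B) && (v \in B)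
    & forall v i j k, (i <= j <= k)%N -> (k < size X)%N ->
        v \in nth finset.set0 X i -> v \in nth finset.set0 X k ->
        v \in nth finset.set0 X j].

Definition width (X : seq {set V}) : nat := (\max_(B <- X) (#|B|.-1))%N.

Lemma path_decomposition_width_exists :
  exists m, `[< exists2 X, path_decomposition X & width X = m >].
Proof.
exists (width [:: [set: V]]); apply/asboolP; exists [:: [set: V]] => //; split.
- by move=> v; exists [set: V]; rewrite ?mem_head ?inE.
- by move=> u v _; exists [set: V]; rewrite ?mem_head ?inE.
- move=> v i j k /andP[_ lejk] /=; rewrite ltnS leqn0 => /eqP k0 _ _.
  by move: lejk; rewrite k0 leqn0 => /eqP->; rewrite /= inE.
Qed.

Definition pathwidth : nat := ex_minn path_decomposition_width_exists.

End Pathwidth.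

(* Main.v *)
(* A graph of pathwidth pw has bags of size at most w = pw + 1 <= 2 pw. Given a
   partition into blocks of strong diameter eps and del = 330 w eps, one builds
   a coarser partition of strong diameter 40 w del such that every ball of
   radius del / 2 meets O(w^2) clusters; iterating from the singletons yields
   the hierarchy with gamma = 13200 w^2 and alpha = 80 w.

   The coarser partition is built in w levels. At each level, every component Y
   of the unclustered part is given a near-shortest path from its leftmost to
   its rightmost bag. The blocks met by the path are grouped into cores of
   length about del which jointly meet every bag met by Y, so that the bags
   shrink and w levels suffice. A core either founds a new cluster, at cost
   10 del times the level, or joins an older cluster along a cheapest tentacle,
   where reaching a vertex of label n costs 10 del n. New labels are costs
   rounded to multiples of 10 del, so the errors made at one level do not add up
   over the levels: cluster radii stay O(w del), and once a ball of radius del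
   has been hit at level j no cluster founded after level j ever enters it. At
   each of the levels up to j only O(w) founding cores lie within O(w del) of
   the ball, because they are spread along a near-shortest path. Tentacles that
   share a block are merged at an error of 3 eps per merge; there are O(w) merges
   in a row because the roots of the tentacles are del apart, whence eps must be
   of order del / w and gamma of order w^2. *)

Require Import Defs.
From mathcomp Require Import all_boot all_order all_algebra.
From mathcomp Require Import boolp classical_sets reals constructive_ereal ereal.
From mathcomp Require Import lra zify.

Set Implicit Arguments.
Unset Strict Implicit.
Unset Printing Implicit Defensive.

Import Order.TTheory GRing.Theory Num.Theory.

Local Open Scope ring_scope.

(** * Walks *)

Section Walks.
Variables (R : realType) (V : finType) (G : wgraph R V).
Implicit Types (D E : V -> Prop) (u v x y z : V) (l : R) (p : seq V).

Lemma walk_length_cons u x p :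
  walk_length G u (x :: p) = wt G u x + walk_length G x p.
Proof. by rewrite /walk_length /= big_cons. Qed.

Lemma walk_length_nil u : walk_length G u [::] = 0.
Proof. by rewrite /walk_length /= big_nil. Qed.

Lemma walk_length_cat u p q :
  walk_length G u (p ++ q) = walk_length G u p + walk_length G (last u p) q.
Proof.
elim: p u => [|x p IH] u /=; first by rewrite walk_length_nil add0r.
by rewrite !walk_length_cons IH addrA.
Qed.

Lemma walk_length_ge0 u p : path (adj G) u p -> 0 <= walk_length G u p.
Proof.
elim: p u => [|x p IH] u /=; first by rewrite walk_length_nil.
by move=> /andP[/(@wt_pos _ _ G) w /IH]; rewrite walk_length_cons; lra.
Qed.

(** [l] is an upper bound rather than the exact length, so distance estimates in induced subgraphs
    become compositions of walks, without infima. *)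
Definition walk D u v l := exists p,
  [/\ path (adj G) u p, last u p = v, (forall x, x \in u :: p -> D x)
    & walk_length G u p <= l].

(** Only the part before the last edge lies in [D]; the endpoint [x] is free, and typically is the
    first vertex outside. *)
Definition exit_walk D u x l := exists y l',
  [/\ walk D u y l', adj G y x & l' + wt G y x <= l].

Lemma walk_refl D u l : D u -> 0 <= l -> walk D u u l.
Proof.
move=> Du l0; exists [::]; split=> //; last by rewrite walk_length_nil.
by move=> x; rewrite inE => /eqP->.
Qed.

Lemma walk_cons D u x v l : D u -> adj G u x -> walk D x v l ->
  walk D u v (wt G u x + l).
Proof.
move=> Du ux [p [pp pl pD pw]]; exists (x :: p); split=> //=; first by rewrite ux.
  by move=> y; rewrite inE => /orP[/eqP->//|]; apply: pD.
by rewrite walk_length_cons lerD2l.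
Qed.

Lemma walk_mono D E u v l l' : (forall x, D x -> E x) -> l <= l' ->
  walk D u v l -> walk E u v l'.
Proof.
move=> DE ll [p [pp pl pD pw]]; exists p; split=> //; first by move=> x /pD /DE.
exact: le_trans ll.
Qed.

Lemma walk_le D u v l l' : l <= l' -> walk D u v l -> walk D u v l'.
Proof. exact: walk_mono. Qed.

Lemma walk_sub D E u v l : (forall x, D x -> E x) -> walk D u v l -> walk E u v l.
Proof. by move=> DE; apply: walk_mono. Qed.

Lemma walk_ge0 D u v l : walk D u v l -> 0 <= l.
Proof. by case=> p [/walk_length_ge0 p0 _ _]; apply: le_trans. Qed.

Lemma walk_domL D u v l : walk D u v l -> D u.
Proof. by case=> p [_ _ pD _]; apply: pD; rewrite mem_head. Qed.

Lemma walk_domR D u v l : walk D u v l -> D v.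
Proof. by case=> p [_ <- pD _]; apply: pD; rewrite mem_last. Qed.

Lemma walk_trans D u v z l1 l2 :
  walk D u v l1 -> walk D v z l2 -> walk D u z (l1 + l2).
Proof.
move=> [p [pp pl pD pw]] [q [qp ql qD qw]]; exists (p ++ q); split.
- by rewrite cat_path pp pl qp.
- by rewrite last_cat pl.
- move=> x; rewrite -cat_cons mem_cat => /orP[/pD//|xq].
  by apply: qD; rewrite inE xq orbT.
- by rewrite walk_length_cat pl lerD.
Qed.

Lemma walk_edge D u v : D u -> D v -> adj G u v -> walk D u v (wt G u v).
Proof.
by move=> Du Dv uv; rewrite -[wt _ _ _]addr0; apply: walk_cons => //; apply: walk_refl.
Qed.

Lemma walk_rind (P : V -> R -> Prop) D v :
  (forall l, D v -> 0 <= l -> P v l) ->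
  (forall u x l l', D u -> adj G u x -> walk D x v l -> P x l ->
     wt G u x + l <= l' -> P u l') ->
  forall u l, walk D u v l -> P u l.
Proof.
move=> P0 PS u l [p [pp pl pD pw]]; elim: p u l pp pl pD pw => [|x p IH] u l /=.
  move=> _ -> Dv; rewrite walk_length_nil => l0.
  by apply: P0 => //; apply: Dv; rewrite mem_head.
move=> /andP[ux xp] pl pD; rewrite walk_length_cons => pw.
have pD' y : y \in x :: p -> D y by move=> yp; apply: pD; rewrite inE yp orbT.
apply: (PS u x (walk_length G x p)) => //; first by apply: pD; rewrite mem_head.
  by exists p; split.
exact: IH.
Qed.

Lemma walk_sym D u v l : walk D u v l -> walk D v u l.
Proof.
move: u l; apply: walk_rind => [l Dv l0|u x l l' Du ux w IH ll].
  exact: walk_refl.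
have Dx := walk_domL w.
apply: (walk_le ll); rewrite addrC; apply: walk_trans IH _.
by rewrite (wt_sym G); apply: walk_edge => //; rewrite (adj_sym G).
Qed.

(* Since walk only asserts existence, this is how one gets hold of a set of
   vertices supporting a walk from u to v of length at most l. *)
Lemma walk_self D u v l : walk D u v l ->
  walk (fun z => D z /\ exists l1 l2, [/\ walk D u z l1, walk D z v l2 & l1 + l2 <= l])
    u v l.
Proof.
move=> [p [pp pl pD pw]]; exists p; split=> // z zp; split; first exact: pD.
move: zp; rewrite inE => /predU1P[->|zp].
  exists 0, l; split; first by apply: walk_refl => //; apply: pD; rewrite mem_head.
    by exists p.
  by rewrite add0r.
case/path.splitP: zp pp pl pD pw => p1 p2.
rewrite cat_path last_cat last_rcons walk_length_cat last_rcons.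
move=> /andP[pp1 pp2] pl pD pw.
exists (walk_length G u (rcons p1 z)), (walk_length G z p2); split=> //.
  exists (rcons p1 z); split=> //; first by rewrite last_rcons.
  by move=> x xp; apply: pD; rewrite -cat_cons mem_cat xp.
exists p2; split=> // x; rewrite inE => xp; apply: pD.
rewrite inE mem_cat mem_rcons inE -!orbA.
by case/orP: xp => ->; rewrite !orbT.
Qed.

Lemma exit_walk_mono D E u x l l' : (forall z, D z -> E z) -> l <= l' ->
  exit_walk D u x l -> exit_walk E u x l'.
Proof.
move=> DE ll [y [l1 [w yx h]]]; exists y, l1; split=> //; first exact: walk_sub w.
exact: le_trans ll.
Qed.

Lemma exit_walk_trans D u v x l1 l2 :
  walk D u v l1 -> exit_walk D v x l2 -> exit_walk D u x (l1 + l2).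
Proof.
move=> w [y [l' [w' yx h]]]; exists y, (l1 + l'); split=> //.
  exact: walk_trans w'.
by rewrite -addrA lerD2l.
Qed.

Lemma exit_walk_cons D u y x l : D u -> adj G u y -> exit_walk D y x l ->
  exit_walk D u x (wt G u y + l).
Proof.
move=> Du uy [z [l' [w zx h]]]; exists z, (wt G u y + l'); split=> //.
  exact: walk_cons.
by rewrite -addrA lerD2l.
Qed.

Lemma exit_walk_ge0 D u x l : exit_walk D u x l -> 0 <= l.
Proof.
by move=> [y [l' [/walk_ge0 l0 /(@wt_pos _ _ G) w h]]]; lra.
Qed.

Lemma exit_walk_domL D u x l : exit_walk D u x l -> D u.
Proof. by move=> [y [l' [/walk_domL]]]. Qed.

Lemma walk_split D E u v l : walk D u v l -> E u ->
  walk (fun z => D z /\ E z) u v l \/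
  exists x l1 l2, [/\ exit_walk (fun z => D z /\ E z) u x l1, ~ E x,
    walk D x v l2 & l1 + l2 <= l].
Proof.
move: u l; apply: walk_rind => [l Dv l0 Ev|u x l l' Du ux w IH ll Eu].
  by left; apply: walk_refl.
have [Ex|nEx] := pselect (E x); last first.
  right; exists x, (wt G u x), l; split=> //.
  by exists u, 0; split; rewrite ?add0r //; apply: walk_refl.
have [w'|[y [l1 [l2 [e nEy w' h]]]]] := IH Ex.
  by left; apply: (walk_le ll); apply: walk_cons.
right; exists y, (wt G u x + l1), l2; split=> //; last by lra.
exact: exit_walk_cons.
Qed.

Lemma walk_exit D E u v l : walk D u v l -> E u -> ~ E v ->
  exists x l1 l2, [/\ exit_walk (fun z => D z /\ E z) u x l1, ~ E x,
    walk D x v l2 & l1 + l2 <= l].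
Proof.
by move=> w Eu nEv; case: (walk_split w Eu) => // /walk_domR[].
Qed.

(** Well-ordering of the naturals replaces a minimum over a possibly infinite type: take the least
    [n] such that some value lies below [n * e]. *)
Lemma near_min (T : Type) (P : T -> Prop) (f : T -> R) (e : R) :
  0 < e -> (exists t, P t) -> (forall t, P t -> 0 <= f t) ->
  exists2 t, P t & forall t', P t' -> f t <= f t' + e.
Proof.
move=> e0 [t0 Pt0] f0.
pose Q n := `[< exists2 t, P t & f t < n%:R * e >].
have exQ : exists n, Q n.
  exists (Num.bound (f t0 / e)); apply/asboolP; exists t0 => //.
  rewrite -ltr_pdivrMr //; apply: le_lt_trans (archi_boundP _); rewrite ?lexx //.
  by rewrite divr_ge0 ?f0 // ltW.
case: (ex_minnP exQ) => n /asboolP[t Pt ft] nmin.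
exists t => // t' Pt'; rewrite leNgt; apply/negP => lt.
case: n ft nmin => [|n] ft nmin; first by have := f0 _ Pt; rewrite mul0r in ft; lra.
suff /nmin : Q n by rewrite ltnn.
apply/asboolP; exists t' => //.
by move: ft; rewrite -natr1 mulrDl mul1r; lra.
Qed.

End Walks.

(** * Cores along a near-shortest path *)

Section Cores.
Variables (R : realType) (V : finType) (G : wgraph R V) (T : eqType) (q : V -> T).
Variables (eps del : R) (Y : V -> Prop).
Hypothesis eps_gt0 : 0 < eps.
Hypothesis del_gt0 : 0 < del.
Hypothesis block_walk :
  forall u v, q u = q v -> walk G (fun x => q x = q u) u v eps.
Hypothesis Y_block : forall u v, q u = q v -> Y u -> Y v.

Definition geodesic (u : V) (p : seq V) : Prop := forall p1 p2 p3 l,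
  p = p1 ++ p2 ++ p3 -> walk G Y (last u p1) (last u (p1 ++ p2)) l ->
  walk_length G (last u p1) p2 <= l + eps.

(** Take a path in [Y] that is shortest up to [eps]. Replacing a middle part by another walk gives a
    competitor, so each middle part is shortest up to the same [eps]. *)
Lemma geodesic_exists a b l : walk G Y a b l -> exists p,
  [/\ path (adj G) a p, last a p = b, (forall x, x \in a :: p -> Y x)
    & geodesic a p].
Proof.
case=> p0 [pp0 pl0 pY0 _].
pose P p := [/\ path (adj G) a p, last a p = b & forall x, x \in a :: p -> Y x].
have [||p [pp pl pY] pmin] := @near_min R (seq V) P (walk_length G a) eps eps_gt0.
- by exists p0; split.
- by move=> t [/walk_length_ge0].
exists p; split=> // p1 p2 p3 l' defp [p2' [p2p p2l p2Y p2w]].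
rewrite last_cat in p2l.
have : P (p1 ++ p2' ++ p3).
  move: pp pl pY; rewrite defp !cat_path !last_cat => /and3P[p1p p2p' p3p] pl pY.
  split; rewrite ?cat_path ?last_cat ?p1p ?p2p ?p2l //.
  move=> x; rewrite -cat_cons !mem_cat => /or3P[xp|xp|xp].
  - by apply: pY; rewrite -cat_cons mem_cat xp.
  - by apply: p2Y; rewrite inE xp orbT.
  - by apply: pY; rewrite -cat_cons !mem_cat xp !orbT.
move/pmin; rewrite defp !walk_length_cat p2l; lra.
Qed.

Lemma geodesic_cat u p1 p2 : geodesic u (p1 ++ p2) -> geodesic (last u p1) p2.
Proof.
move=> g r1 r2 r3 l def; have := g (p1 ++ r1) r2 r3 l.
by rewrite !last_cat def !catA => /(_ erefl).
Qed.

(** Core [A i] starts at the path vertex [s i], whose position along the path is [pos i]. The [eps]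
    terms pay for crossing one block, or, in [core_geod], for the path being only nearly
    shortest. *)
Record core_chain (a b : V) (N : nat) (s : nat -> V) (pos : nat -> R)
    (A : nat -> V -> Prop) : Prop := CoreChain {
  core_N : (0 < N)%N;
  core_first : s 0%N = a;
  core_last : A N.-1 b;
  core_block : forall i u v, (i < N)%N -> q u = q v -> A i u -> A i v;
  core_Y : forall i v, (i < N)%N -> A i v -> Y v;
  core_inj : forall i j v, (i < N)%N -> (j < N)%N -> A i v -> A j v -> i = j;
  core_start : forall i, (i < N)%N -> A i (s i);
  core_gap : forall i, (i.+1 < N)%N -> pos i + del < pos i.+1;
  core_step : forall i, (i.+1 < N)%N ->
    exit_walk G (A i) (s i) (s i.+1) (pos i.+1 - pos i + eps);
  core_walk : forall i v, (i < N)%N -> A i v -> walk G (A i) v (s i) (del + eps);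
  core_geod : forall i j l, (i < j)%N -> (j < N)%N -> walk G Y (s i) (s j) l ->
    pos j - pos i <= l + eps }.

Lemma take_length u p : path (adj G) u p -> exists p1 p2,
  [/\ p = p1 ++ p2, walk_length G u p1 <= del
    & forall p3 p4, p2 = p3 ++ p4 -> p3 != [::] -> del < walk_length G u (p1 ++ p3)].
Proof.
elim/last_ind: p => [|p x IH].
  move=> _; exists [::], [::]; split; rewrite ?walk_length_nil ?ltW //.
  by move=> [].
rewrite rcons_path => /andP[pp xp].
have [p1 [p2 [defp w h]]] := IH pp.
have [lt|le] := ltP del (walk_length G u (rcons p x)); last first.
  exists (rcons p x), [::]; split; rewrite ?cats0 // => - [|y r] //.
exists p1, (rcons p2 x); split=> //; first by rewrite defp rcons_cat.
move=> p3; elim/last_ind => [|p4 y _].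
  by rewrite cats0 => <- _; rewrite -rcons_cat -defp.
by rewrite -rcons_cat => /rcons_inj[/h].
Qed.

Lemma split_last (P : pred V) (p : seq V) : exists p1 p2,
  [/\ p = p1 ++ p2, ~~ has P p2 & forall x, p1 != [::] -> P (last x p1)].
Proof.
elim/last_ind: p => [|p x [p1 [p2 [defp h1 h2]]]]; first by exists [::], [::].
have [Px|nPx] := boolP (P x).
  by exists (rcons p x), [::]; split; rewrite ?cats0 // => y _; rewrite last_rcons.
exists p1, (rcons p2 x); split=> //; first by rewrite defp rcons_cat.
by rewrite has_rcons negb_or nPx.
Qed.

(* The core of u consists of the blocks met by the initial stretch of p of
   length at most del; the next core starts right after the last vertex of p
   lying in one of those blocks, so that no block is shared. *)
Lemma core_chain_exists u p : path (adj G) u p ->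
  (forall x, x \in u :: p -> Y x) -> geodesic u p ->
  exists N s pos A, core_chain u (last u p) N s pos A.
Proof.
move=> pp pY g.
(* Besides the first position, the induction must know that cores consist of blocks met by the path,
   for disjointness, and that prefixes witness the positions, for applying [g] to the whole path. *)
suff [N [s [pos [A [C _ _ _]]]]] : exists N s pos A,
  [/\ core_chain u (last u p) N s pos A,
    pos 0%N = 0,
    forall i v, (i < N)%N -> A i v -> exists2 t, t \in u :: p & q t = q v
  & forall i, (i < N)%N -> exists p1 p2,
      [/\ p = p1 ++ p2, last u p1 = s i & walk_length G u p1 = pos i]].
  by exists N, s, pos, A.
elim: {p}(size p) {-2}p (leqnn (size p)) u pp pY g => [|n IH] p szp u pp pY g.
  case: p szp pp pY g => // _ _ pY _.
  exists 1%N, (fun=> u), (fun=> 0), (fun _ v => q v = q u); split=> //.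
  - split=> //.
    + by move=> i v w _ ->.
    + move=> i v _ qv; apply: (@Y_block u) => //; apply: pY; rewrite mem_head //.
    + by move=> [|i] [|j].
    + move=> i v _ qv; apply: (@walk_le _ _ _ _ _ _ eps); first by rewrite lerDr ltW.
      by have := block_walk (esym qv); rewrite -?qv => /walk_sym; apply: walk_sub.
    + by move=> i j l ij; rewrite ltnS leqn0 => /eqP j0; rewrite j0 in ij.
  - by move=> i v _ ->; exists u; rewrite ?mem_head.
  - by move=> i _; exists [::], [::]; rewrite walk_length_nil.
have [p1 [p2 [defp wp1 hp1]]] := take_length pp.
pose D x := q x \in map q (u :: p1).
have [p3 [p4 [defp2 np4 hp3]]] := split_last D p2.
pose y := last u (p1 ++ p3).
have Dp1 x : x \in u :: p1 -> D x by move=> xp; apply: map_f.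
have Dy : D y.
  rewrite /y last_cat; have [->|/hp3//] := eqVneq p3 [::].
  exact: Dp1 (mem_last _ _).
have mp1 x : x \in u :: p1 -> x \in u :: p.
  by rewrite defp -cat_cons mem_cat => ->.
have DY x : D x -> Y x.
  by case/mapP=> t tp qt; apply: (@Y_block t) => //; apply/pY/mp1.
have Dblock x z : q x = q z -> D x -> D z by rewrite /D => ->.
have [up1 up2] : path (adj G) u p1 /\ path (adj G) (last u p1) p2.
  by move: pp; rewrite defp cat_path => /andP.
(* from u along p1 to t, then inside the block of t *)
have Dwalk l x t : q t = q x -> forall r1 r2, p1 = r1 ++ r2 -> last u r1 = t ->
    walk_length G u r1 <= l -> walk G D u x (l + eps).
  move=> qt r1 r2 dp1 lr wr; apply: (@walk_trans _ _ _ _ _ t).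
    exists r1; split=> //; first by move: up1; rewrite dp1 cat_path => /andP[].
    by move=> z zr; apply: Dp1; rewrite dp1 -cat_cons mem_cat zr.
  apply: walk_sub (block_walk qt) => z qz; rewrite /D qz; apply: map_f.
  by rewrite dp1 -lr -cat_cons mem_cat mem_last.
have splitp1 t : t \in u :: p1 -> exists r1 r2, p1 = r1 ++ r2 /\ last u r1 = t.
  by case/path.splitPl=> r1 r2 <-; exists r1, r2.
have Dcore x : D x -> walk G D x u (del + eps).
  move=> /mapP[t tp qt]; apply: walk_sym.
  have [r1 [r2 [dp lr]]] := splitp1 _ tp.
  apply: (@Dwalk _ _ t _ r1 r2) => //; move: wp1 up1.
  rewrite dp cat_path walk_length_cat => wp1 /andP[_ /walk_length_ge0]; lra.
case: p4 defp2 np4 => [|s1 p5].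
  rewrite cats0 => defp2 _; have yE : y = last u p by rewrite /y -defp2 -defp.
  exists 1%N, (fun=> u), (fun=> 0), (fun=> D); split=> //.
  - split=> //.
    + by rewrite -yE.
    + by move=> i v w _; apply: Dblock.
    + by move=> i v _; apply: DY.
    + by move=> [|i] [|j].
    + by move=> i _; apply: Dp1; rewrite mem_head.
    + by move=> i v _; apply: Dcore.
    + by move=> i j l ij; rewrite ltnS leqn0 => /eqP j0; rewrite j0 in ij.
  - by move=> i v _ /mapP[t tp ->]; exists t => //; apply: mp1.
  - by move=> i _; exists [::], p; rewrite walk_length_nil.
move=> defp2 np5.
have defp' : p = (p1 ++ p3) ++ s1 :: p5 by rewrite defp defp2 catA.
have [ys1 ps1 pp13] : [/\ adj G y s1, path (adj G) s1 p5 & path (adj G) u (p1 ++ p3)].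
  by move: pp; rewrite defp' cat_path /= => /and3P[].
have defp'' : p = rcons (p1 ++ p3) s1 ++ p5 by rewrite defp' cat_rcons.
have [||||N [s [pos [A [C pos0 hA hs]]]]] := IH p5 _ s1.
- by move: szp; rewrite defp' size_cat /=; lia.
- exact: ps1.
- by move=> x xp; apply: pY; rewrite defp' -cat_cons mem_cat xp orbT.
- have -> : s1 = last u (rcons (p1 ++ p3) s1) by rewrite last_rcons.
  by apply: geodesic_cat; rewrite -defp''.
(* Later cores consist of blocks met by [s1 :: p5], which avoids [D] since the path was cut after
   its last vertex in [D]. *)
have nDA i v : (i < N)%N -> A i v -> ~ D v.
  move=> iN /(hA i v iN)[t tp qt] Dv.
  move/hasPn: np5 => /(_ t tp); apply/negP; rewrite negbK.
  by rewrite /D qt.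
pose off := walk_length G u (rcons (p1 ++ p3) s1).
have offE : off = walk_length G u (p1 ++ p3) + wt G y s1.
  by rewrite /off -cats1 walk_length_cat walk_length_cons walk_length_nil addr0.
have off_gt : del < off.
  rewrite /off rcons_cat; apply: (hp1 _ p5); first by rewrite defp2 cat_rcons.
  by case: (p3).
pose s' i := if i is j.+1 then s j else u.
pose pos' i := if i is j.+1 then off + pos j else 0.
pose A' i : V -> Prop := if i is j.+1 then A j else D.
have hs' i : (i < N.+1)%N -> exists r1 r2,
    [/\ p = r1 ++ r2, last u r1 = s' i & walk_length G u r1 = pos' i].
  case: i => [|i] iN; first by exists [::], p; rewrite walk_length_nil.
  have [r1 [r2 [dp lr wr]]] := hs i iN.
  exists (rcons (p1 ++ p3) s1 ++ r1), r2; split.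
  - by rewrite defp'' dp catA.
  - by rewrite last_cat last_rcons.
  - by rewrite walk_length_cat last_rcons wr.
have lastE : last s1 p5 = last u p by rewrite defp' last_cat.
exists N.+1, s', pos', A'; split=> //.
- case: C => [N0 s0 lastb Ablock AY Ainj Astart gap step wlk geo]; split=> //.
  + by case: (N) N0 lastb => // N' _; rewrite lastE.
  + move=> [|i] v w iN; first exact: Dblock.
    exact: Ablock.
  + by move=> [|i] v iN; [apply: DY | apply: AY].
  + move=> [|i] [|j] v iN jN //.
    * by move=> Dv /(nDA _ _ jN).
    * by move=> /(nDA _ _ iN).
    * by move=> Av Av'; congr S; apply: Ainj Av'.
  + by move=> [|i] iN; [apply: Dp1; rewrite mem_head | apply: Astart].
  + move=> [|i] iN; rewrite /pos'; first by rewrite pos0 add0r addr0.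
    by rewrite -addrA ltrD2l; apply: gap.
  + move=> [|i] iN; rewrite /pos' /=.
      rewrite pos0 s0 subr0 addr0 offE.
      (* [y] may lie beyond [p1], but shares a block with some [t] on it: walk to [t], cross the
         block at cost [eps], and step to [s1]. *)
      have /mapP[t tp qt] := Dy.
      have [r1 [r2 [dp lr]]] := splitp1 _ tp.
      exists y, (walk_length G u p1 + eps); split=> //.
        apply: (@Dwalk _ _ t _ r1 r2) => //.
        move: up1; rewrite dp walk_length_cat cat_path => /andP[_ /walk_length_ge0].
        lra.
      move: pp13; rewrite walk_length_cat cat_path => /andP[_ /walk_length_ge0].
      lra.
    by have := step i iN; rewrite opprD addrACA subrr add0r.
  + by move=> [|i] v iN; [apply: Dcore | apply: wlk].
  + move=> [|i] [|j] l ij jN //; rewrite /pos' /s'.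
      have [r1 [r2 [dp lr wr]]] := hs' j.+1 jN.
      rewrite subr0 -[off + _]wr => w.
      by apply: (g [::] r1 r2 l) => //=; rewrite lr.
    by rewrite opprD addrACA subrr add0r; apply: geo.
- move=> [|i] v iN; first by move=> /mapP[t tp ->]; exists t => //; apply: mp1.
  move=> /(hA i v iN)[t tp qt]; exists t => //.
  by rewrite defp' -cat_cons mem_cat tp orbT.
Qed.

Variables (a b : V) (N : nat) (s : nat -> V) (pos : nat -> R) (A : nat -> V -> Prop).
Hypothesis C : core_chain a b N s pos A.

Lemma core_pos_gap i j : (i < j)%N -> (j < N)%N -> pos i + del < pos j.
Proof.
elim: j => // j IH; rewrite ltnS leq_eqVlt => /predU1P[->|ij] jN.
  exact: (core_gap C).
have := IH ij (ltnW jN); have := core_gap C jN; have := del_gt0; lra.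
Qed.

Lemma core_dist i j l : (i < N)%N -> (j < N)%N -> walk G Y (s i) (s j) l ->
  `|pos i - pos j| <= l + eps.
Proof.
move=> iN jN w; have l0 := walk_ge0 w; have e0 := eps_gt0; have d0 := del_gt0.
have [ij|ji|->] := ltngtP i j.
- have := core_geod C ij jN w; have := core_pos_gap ij jN.
  by rewrite ler_norml => *; apply/andP; split; lra.
- have := core_geod C ji iN (walk_sym w); have := core_pos_gap ji iN.
  by rewrite ler_norml => *; apply/andP; split; lra.
by rewrite subrr normr0; lra.
Qed.

Lemma core_pos_inj i j : (i < N)%N -> (j < N)%N -> pos i = pos j -> i = j.
Proof.
move=> iN jN e; have d0 := del_gt0; have [ij|ji|->//] := ltngtP i j.
  by have := core_pos_gap ij jN; rewrite e -ltrBrDl subrr ltNge (ltW d0).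
by have := core_pos_gap ji iN; rewrite e -ltrBrDl subrr ltNge (ltW d0).
Qed.

End Cores.

(** * Clustering one component *)

Section Tube.
Variables (R : realType) (V : finType) (G : wgraph R V).

(** The ellipse with foci [u] and [v] inside [D], a canonical support for walks that are only known
    to exist. *)
Definition tube (D : V -> Prop) (u v : V) (l : R) (z : V) := exists l1 l2,
  [/\ walk G D u z l1, walk G D z v l2 & l1 + l2 <= l].

Lemma tube_walk D u v l l1 l2 z : walk G D u z l1 -> walk G D z v l2 ->
  l1 + l2 <= l -> walk G (tube D u v l) z v l2.
Proof.
move=> w1 w2 h; have := walk_self w2; apply: walk_sub => y [_ [a1 [a2 [wa wb ha]]]].
by exists (l1 + a1), a2; split=> //; [apply: walk_trans wa | lra].
Qed.

End Tube.

Section Level.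
Variables (R : realType) (V : finType) (G : wgraph R V) (T : eqType) (q : V -> T).
Variables (eps del : R) (Y : V -> Prop).
Hypothesis eps_gt0 : 0 < eps.
Hypothesis del_gt0 : 0 < del.
Hypothesis block_walk :
  forall u v, q u = q v -> walk G (fun x => q x = q u) u v eps.
Hypothesis Y_block : forall u v, q u = q v -> Y u -> Y v.
Variables (lam : V -> R) (top : R).
Hypothesis lam_ge0 : forall x, 0 <= lam x.
Hypothesis top_ge0 : 0 <= top.
Hypothesis eps_small : 30%:R * eps * (top + del) <= del * del.
Variables (a b : V) (N : nat) (s : nat -> V) (pos : nat -> R) (A : nat -> V -> Prop).
Hypothesis C : core_chain G q eps del Y a b N s pos A.

Definition core v := exists2 i, (i < N)%N & A i v.
Definition noncore v := Y v /\ ~ core v.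

Lemma noncore_block u v : q u = q v -> noncore u -> noncore v.
Proof.
move=> quv [Yu nu]; split; first exact: Y_block Yu.
by move=> [i iN Av]; apply: nu; exists i => //; apply: (core_block C iN (esym quv) Av).
Qed.

Lemma noncore_Y v : noncore v -> Y v.
Proof. by move=> []. Qed.

(** Strictly between [u], which will be a core vertex, and [x], all cores are avoided. The single
    edge is a separate case because [exit_walk] would require [u] to be noncore. *)
Definition clean_exit u x l := (adj G u x /\ wt G u x <= l) \/
  exists y l', [/\ adj G u y, exit_walk G noncore y x l' & wt G u y + l' <= l].

(** Cut the walk at its last core vertex; what remains is a clean exit. *)
Lemma exit_last_core u x l : exit_walk G Y u x l -> exit_walk G noncore u x l \/
  exists z i l1 l2, [/\ (i < N)%N, A i z, walk G Y u z l1, clean_exit z x l2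
    & l1 + l2 <= l].
Proof.
move=> [y [l0 [w yx h]]].
suff H : forall u l, walk G Y u y l ->
    exit_walk G noncore u x (l + wt G y x) \/
    exists z i l1 l2, [/\ (i < N)%N, A i z, walk G Y u z l1, clean_exit z x l2
      & l1 + l2 <= l + wt G y x].
  have [e|[z [i [l1 [l2 [iN Az w' c hl]]]]]] := H _ _ w.
    by left; apply: exit_walk_mono e.
  by right; exists z, i, l1, l2; split=> //; apply: le_trans hl h.
apply: walk_rind => {w} [l1 Yy l10|{}u z l1 l2 Yu uz w IH hl].
  have [[i iN Ai]|nc] := pselect (core y); last first.
    by left; exists y, 0; split=> //; [apply: walk_refl | rewrite add0r lerDr].
  right; exists y, i, 0, (wt G y x); split=> //; first exact: walk_refl.
    by left.
  by rewrite add0r lerDr.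
case: IH => [e|[z' [i [r1 [r2 [iN Az w' c hr]]]]]]; last first.
  right; exists z', i, (wt G u z + r1), r2; split=> //; first exact: walk_cons.
  lra.
have [[i iN Ai]|nc] := pselect (core u); last first.
  left; apply: (@exit_walk_mono _ _ _ noncore _ _ _ (wt G u z + (l1 + wt G y x))) => //.
    by lra.
  exact: exit_walk_cons.
right; exists u, i, 0, (wt G u z + (l1 + wt G y x)); split=> //.
- exact: walk_refl.
- by right; exists z, (l1 + wt G y x).
- by lra.
Qed.

Lemma clean_exit_ge0 u x l : clean_exit u x l -> 0 <= l.
Proof.
case=> [[/(@wt_pos _ _ G)]|[y [l' [/(@wt_pos _ _ G) w /exit_walk_ge0]]]]; lra.
Qed.

(* kap i is the cost of leaving core i without meeting another core, capped
   by the cost top of founding a new cluster; att i tells which one it is. *)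
Definition tentacle_spec (i : nat) (k : R) (att : bool) (u x : V) := (i < N)%N ->
  [/\ 0 <= k <= top,
    forall u' x' l, A i u' -> ~ Y x' -> clean_exit u' x' l -> k <= l + lam x' + eps
  & if att then [/\ A i u, ~ Y x & clean_exit u x (k - lam x)] else k = top].

(** Take a nearly cheapest clean exit among those of cost at most [top]; if there is none, [top]
    itself is a valid lower bound. *)
Lemma tentacle_exists i : exists d : R * bool * V * V,
  tentacle_spec i d.1.1.1 d.1.1.2 d.1.2 d.2.
Proof.
pose P (d : V * V * R) := [/\ A i d.1.1, ~ Y d.1.2, clean_exit d.1.1 d.1.2 d.2
  & d.2 + lam d.1.2 <= top].
have [exP|nP] := pselect (exists d, P d); last first.
  exists (top, false, a, a) => iN; split=> //; first by rewrite top_ge0 lexx.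
  move=> u x l Au nYx cl; rewrite leNgt; apply/negP => lt; apply: nP.
  by exists (u, x, l); split=> //=; move: lt => /=; have := eps_gt0; lra.
have [|[[u x] l] [/= Au nYx cl ltop] lmin] :=
  near_min (f := fun d : V * V * R => d.2 + lam d.1.2) eps_gt0 exP.
  by move=> [[u x] l] [/= _ _ /clean_exit_ge0 l0 _]; rewrite addr_ge0.
exists (l + lam x, true, u, x) => iN; split=> //=.
- by rewrite ltop addr_ge0 // (clean_exit_ge0 cl).
- move=> u' x' l' Au' nYx' cl'; have e0 := eps_gt0.
  have [le|lt] := leP (l' + lam x') top; last by lra.
  exact: (lmin (u', x', l')).
- by rewrite addrK.
Qed.

(** * Voronoi cells of the cores *)

Variables (kap : nat -> R) (att : nat -> bool) (us xs : nat -> V).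
Hypothesis tentacle : forall i, tentacle_spec i (kap i) (att i) (us i) (xs i).

(** The price for core [i] of running along the path to core [j] and leaving by the tentacle of
    [j]. *)
Definition cost i j := `|pos i - pos j| + kap j.

Definition is_root i j := [/\ (j < N)%N,
  forall k, (k < N)%N -> cost i j <= cost i k
  & forall k, (k < j)%N -> cost i j < cost i k].

Lemma root_exists i : exists j, is_root i j.
Proof.
have N0 := core_N C.
pose P j := (j < N)%N && [forall k : 'I_N, cost i j <= cost i k].
have exP : exists j, P j.
  case: (@Order.TotalTheory.arg_minP _ _ _ (Ordinal N0) predT
    (fun k : 'I_N => cost i k) erefl) => j _ jmin.
  by exists j; rewrite /P ltn_ord; apply/forallP => k; apply: jmin.
case: (ex_minnP exP) => j /andP[jN /forallP jmin] jfirst; exists j; split=> //.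
- by move=> k kN; apply: (jmin (Ordinal kN)).
- move=> k kj; rewrite ltNge; apply/negP => le.
  have kN := ltn_trans kj jN.
  have : P k by rewrite /P kN; apply/forallP => m; apply: le_trans le (jmin m).
  by move/jfirst; rewrite leqNgt kj.
Qed.

Variable ro : nat -> nat.
Hypothesis ro_root : forall i, is_root i (ro i).

Lemma pos_le i j : (i <= j)%N -> (j < N)%N -> pos i <= pos j.
Proof.
rewrite leq_eqVlt => /predU1P[->//|ij] jN.
have := core_pos_gap del_gt0 C ij jN; have := del_gt0; lra.
Qed.

(* With ties broken by the smallest index the cells of this one-dimensional
   Voronoi diagram are intervals containing their root. *)
Lemma root_between i k : (i < N)%N ->
  (i <= k <= ro i)%N || (ro i <= k <= i)%N -> ro k = ro i.
Proof.
move=> iN ik; have [jN jmin jfirst] := ro_root i.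
have [mN mmin mfirst] := ro_root k.
have kN : (k < N)%N by lia.
have dist : `|pos i - pos (ro i)| = `|pos i - pos k| + `|pos k - pos (ro i)|.
  case/orP: ik => /andP[h1 h2].
    have p1 := pos_le h1 kN; have p2 := pos_le h2 jN.
    by rewrite !ler0_norm; lra.
  have p1 := pos_le h1 kN; have p2 := pos_le h2 iN.
  by rewrite !ger0_norm; lra.
have tri m : `|pos i - pos m| <= `|pos i - pos k| + `|pos k - pos m|.
  exact: ler_distD.
have [lt|gt|//] := ltngtP (ro k) (ro i).
- exfalso; have := jfirst _ lt; have := mmin _ jN; have := tri (ro k); rewrite /cost; lra.
- exfalso; have := mfirst _ gt; have := jmin _ mN; have := tri (ro k); rewrite /cost; lra.
Qed.

Lemma root_idem i : (i < N)%N -> ro (ro i) = ro i.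
Proof. by move=> iN; apply: root_between => //; rewrite leqnn; case: leqP => //= /ltnW. Qed.

Definition psi i := cost i (ro i).

Lemma psi_le_kap i : (i < N)%N -> psi i <= kap i.
Proof.
move=> iN; have [_ jmin _] := ro_root i; have := jmin _ iN.
by rewrite /psi /cost subrr normr0 add0r.
Qed.

Lemma psi_root i : (i < N)%N -> psi (ro i) = kap (ro i).
Proof. by move=> iN; rewrite /psi root_idem // /cost subrr normr0 add0r. Qed.

Lemma kap_ge0 i : (i < N)%N -> 0 <= kap i.
Proof. by move=> /tentacle[/andP[]]. Qed.

Lemma kap_le_top i : (i < N)%N -> kap i <= top.
Proof. by move=> /tentacle[/andP[]]. Qed.

(** Follow the walk to its last core [j]. Positions change by at most its length plus
    [2 del + 3 eps], and [kap j] is minimal up to [eps]; the root of [i] is no dearer than [j]. *)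
Lemma psi_exit i u x l : (i < N)%N -> A i u -> exit_walk G Y u x l -> ~ Y x ->
  psi i <= l + lam x + 2%:R * del + 4%:R * eps.
Proof.
move=> iN Au e nYx.
have [e'|[z [j [l1 [l2 [jN Az w cl h]]]]]] := exit_last_core e.
  by case: (exit_walk_domL e') => _ []; exists i.
have [_ kmin _] := tentacle jN; have := kmin _ _ _ Az nYx cl.
have wY k v : (k < N)%N -> A k v -> walk G Y v (s k) (del + eps).
  move=> kN Av; have := core_walk C kN Av; apply: walk_sub => t.
  exact: (core_Y C).
have := core_dist eps_gt0 del_gt0 C iN jN
  (walk_trans (walk_sym (wY _ _ iN Au)) (walk_trans w (wY _ _ jN Az))).
have [_ jmin _] := ro_root i; have := jmin _ jN; rewrite -/(psi i) /cost; lra.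
Qed.

(** * Laying and merging tentacles *)

Definition th : R := 3%:R * eps / del.

Lemma th_del : th * del = 3%:R * eps.
Proof. by rewrite /th divfK // gt_eqF. Qed.

Lemma th_gt0 : 0 < th.
Proof. by rewrite divr_gt0 // mulr_gt0. Qed.

(** A merge costs [3 eps] and roots are more than [del] apart, so a toll of [th] per unit of
    position pays for it; tolls telescope over successive merges. *)
Lemma th_gap i j : (i < j)%N -> (j < N)%N ->
  3%:R * eps <= th * (pos j - pos i).
Proof.
move=> ij jN; rewrite -th_del ler_pM2l ?th_gt0 //.
have := core_pos_gap del_gt0 C ij jN; lra.
Qed.

(* t lies on the tentacle of core j, after an initial stretch of length h; the
   rest of the tentacle costs rho. *)
Definition on_tentacle j t h rho := exists y l,
  [/\ adj G (us j) y, walk G noncore y t l, wt G (us j) y + l <= h,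
      exit_walk G noncore t (xs j) (rho - lam (xs j)) & h + rho <= kap j].

Definition root_att j := [&& (j < N)%N, ro j == j & att j].

Lemma on_tentacle_h j t h rho : on_tentacle j t h rho -> 0 <= h.
Proof. by case=> y [l [/(@wt_pos _ _ G) w0 /walk_ge0 l0 h0 _ _]]; lra. Qed.

Lemma root_attP j : root_att j -> [/\ (j < N)%N, ro j = j, A j (us j), ~ Y (xs j)
  & clean_exit (us j) (xs j) (kap j - lam (xs j))].
Proof. by case/and3P=> jN /eqP rj aj; have := tentacle jN; rewrite aj => -[_ _ []]. Qed.

Lemma us_walk j : root_att j -> walk G Y (us j) (s j) (del + eps).
Proof.
move=> /root_attP[jN _ Au _ _]; have := core_walk C jN Au.
by apply: walk_sub => v; apply: (core_Y C).
Qed.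

Lemma on_tentacle_walk j t h rho : root_att j -> on_tentacle j t h rho ->
  walk G Y (us j) t h.
Proof.
move=> rj [y [l [uy w hl _ _]]]; apply: (walk_le hl); apply: walk_cons uy _.
  exact: walk_domL (us_walk rj).
exact: walk_sub noncore_Y w.
Qed.

(** The start of the tentacle has the nearly optimal cost [kap j = psi j]; the initial stretch [h]
    occurs on both sides and cancels. *)
Lemma on_tentacle_exit j t h rho x l : root_att j -> on_tentacle j t h rho ->
  exit_walk G Y t x l -> ~ Y x -> rho <= l + lam x + 2%:R * del + 4%:R * eps.
Proof.
move=> rj tj e nYx; have [jN rjj Au _ _] := root_attP rj.
have := psi_exit jN Au (exit_walk_trans (on_tentacle_walk rj tj) e) nYx.
have := psi_root jN; rewrite rjj => ->.
by case: tj => y [l' [_ _ _ _]]; lra.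
Qed.

Lemma on_tentacle_min j t h rho x l : root_att j -> on_tentacle j t h rho ->
  exit_walk G noncore t x l -> ~ Y x -> rho <= l + lam x + eps.
Proof.
move=> rj [y [l' [uy w hl _ hr]]] e nYx; have [jN _ Au _ _] := root_attP rj.
have [_ kmin _] := tentacle jN.
have cl : clean_exit (us j) x (h + l).
  right; exists y, (l' + l); split=> //; first exact: exit_walk_trans e.
  by lra.
have := kmin _ _ _ Au nYx cl; lra.
Qed.

(** The term [th * (pos j - pos e)] pays for all merges leading from root [j] to the root [e] whose
    exit is finally used. The second clause serves to bound [pos j - pos e]. *)
Definition reaches (D : V -> Prop) j e t rho :=
  exit_walk G D t (xs e) (rho + th * (pos j - pos e) - lam (xs e)) /\
  walk G Y t (s e) (rho + th * (pos j - pos e) + top + del + eps).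

Lemma reaches_mono (D E : V -> Prop) j e t rho : (forall v, D v -> E v) ->
  reaches D j e t rho -> reaches E j e t rho.
Proof. by move=> DE [e1 e2]; split=> //; apply: exit_walk_mono e1. Qed.

Lemma reaches_le (D : V -> Prop) j i e t r1 r2 :
  r1 + th * (pos j - pos e) <= r2 + th * (pos i - pos e) ->
  reaches D j e t r1 -> reaches D i e t r2.
Proof.
move=> le [e1 e2]; split; first by apply: exit_walk_mono e1 => //; lra.
by apply: walk_le e2; lra.
Qed.

Lemma reaches_trans (D : V -> Prop) j e t t' l r :
  (forall v, D v -> Y v) -> walk G D t t' l ->
  reaches D j e t' r -> reaches D j e t (l + r).
Proof.
move=> DY w [e1 e2]; split.
  apply: exit_walk_mono (exit_walk_trans w e1) => //; lra.
apply: walk_le (walk_trans (walk_sub DY w) e2); lra.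
Qed.

Lemma reaches_cons (D : V -> Prop) j e t t' r :
  (forall v, D v -> Y v) -> D t -> adj G t t' ->
  reaches D j e t' r -> reaches D j e t (wt G t t' + r).
Proof.
move=> DY Dt tt' [e1 e2]; split.
  apply: exit_walk_mono (exit_walk_cons Dt tt' e1) => //; lra.
apply: walk_le (walk_cons (DY _ Dt) tt' e2); lra.
Qed.

Definition owned_by (g : V -> option nat) e (v : V) := g v = Some e.

(** The state after the tentacles of the roots below [n] are laid: [g] sends a block to the root
    whose exit it uses. An owned vertex shares a block with some vertex [t] of a tentacle. *)
Definition owned_spec n (g : V -> option nat) :=
  (forall u v, q u = q v -> g u = g v) /\
  forall v e, g v = Some e -> noncore v /\ exists j t h rho,
    [/\ (e <= j < n)%N, root_att j && root_att e, on_tentacle j t h rho, q t = q v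
      & reaches (owned_by g e) j e t rho].

Definition root_spec n (g : V -> option nat) (en : nat -> nat) :=
  forall j, (j < n)%N -> root_att j -> [/\ (en j <= j)%N, root_att (en j)
    & reaches (fun v => v = us j \/ owned_by g (en j) v) j (en j) (us j) (kap j)].

(* Joining the tentacle of an earlier root i < n through a common block costs
   3 eps, which is paid for by the distance between the two roots. *)
Lemma tentacle_join n g e t l rho : owned_spec n g -> root_att n ->
  g t = Some e -> exit_walk G noncore t (xs n) l -> l + lam (xs n) <= rho ->
  [/\ (e < n)%N, root_att e & reaches (owned_by g e) n e t rho].
Proof.
move=> [gq go] rn gt ex lrho; have [nct [i [t' [h [r [/andP[ei iN] /andP[ri re] ti qt rch]]]]]] := go _ _ gt.
have [nN _ _ nYx _] := root_attP rn.
have g' : forall v, owned_by g e v -> Y v by move=> v /go[/noncore_Y].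
split=> //; first exact: leq_ltn_trans iN.
have wb := block_walk qt.
have wnc : walk G noncore t' t eps.
  by apply: walk_sub wb => v qv; apply: noncore_block nct; rewrite qv.
have wow : walk G (owned_by g e) t t' eps.
  apply: walk_sym; apply: walk_sub wb => v qv.
  by rewrite /owned_by -gt; apply: gq; rewrite qv.
have := on_tentacle_min ri ti (exit_walk_trans wnc ex) nYx => rle.
have := reaches_trans g' wow rch.
apply: reaches_le.
(* One [eps] is for walking from [t] to [t'], one for walking back in the comparison [rle], and one
   for the near-minimality of [kap i]. *)
have gap := th_gap iN nN; move: gap rle lrho; rewrite !mulrBr; lra.
Qed.

(** The tentacle of [n] is followed until it meets an owned vertex, whose owner [e] takes over, or
    until its end, and then [e = n]. The blocks of the fresh stretch are given to [e]. *)
Lemma own_tentacle n g : root_att n -> owned_spec n g -> exists g' e,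
  [/\ forall v k, g v = Some k -> g' v = Some k, owned_spec n.+1 g',
      ((e <= n)%N /\ root_att e)
    & reaches (fun v => v = us n \/ owned_by g' e v) n e (us n) (kap n)].
Proof.
move=> rn [gq go]; have [nN _ Au nYx cl] := root_attP rn.
have goS : owned_spec n.+1 g.
  split=> // v e /go[ncv [j [t [h [r [/andP[ej jn] rje tj qt rch]]]]]].
  by split=> //; exists j, t, h, r; split=> //; rewrite ej ltnW.
have kN0 := kap_ge0 nN; have kNt := kap_le_top nN.
have [e0 d0] := (eps_gt0, del_gt0).
have lx := lam_ge0 (xs n).
have Yu : Y (us n) := walk_domL (us_walk rn).
case: cl => [[ux uw]|[y [l' [uy ey hl]]]].
  exists g, n; split=> //; split.
    exists (us n), 0; split=> //; first by apply: walk_refl => //; left.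
    by rewrite subrr mulr0; lra.
  apply: walk_le (us_walk rn); rewrite subrr mulr0; lra.
have w0 := wt_pos uy; have l'0 := exit_walk_ge0 ey.
pose r0 := kap n - wt G (us n) y.
case gy: (g y) => [e|].
  have [||en' re rch] := @tentacle_join n g e y l' r0 _ rn gy ey.
  - by split.
  - by rewrite /r0; lra.
  exists g, e; split=> //; first by rewrite ltnW.
  have -> : kap n = wt G (us n) y + r0 by rewrite /r0; lra.
  apply: (reaches_cons _ _ uy); first by move=> v [->|/go[/noncore_Y]].
    by left.
  by apply: reaches_mono rch => v; right.
case: (ey) => z0 [l0 [wz0 zx0 hz0]].
pose D v := noncore v /\ g v = None.
(* the stretch of the tentacle, from y to z, which is not yet owned *)
have [z [l [e [wz hle [ele re] nz rz]]]] : exists z l e,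
    [/\ walk G D y z l, l <= r0, ((e <= n)%N /\ root_att e),
      exit_walk G noncore z (xs n) (r0 - l - lam (xs n))
    & reaches (fun v => v = z \/ owned_by g e v) n e z (r0 - l)].
  have [w|[t [l1 [l2 [[z [lz [wz zt hz]]] ng w2 h12]]]]] :=
    walk_split (E := fun v => g v = None) wz0 gy.
    have wpos := wt_pos zx0; have l00 := walk_ge0 w.
    exists z0, l0, n; split=> //; first by rewrite /r0; lra.
      exists z0, 0; split=> //; last by rewrite /r0; lra.
      by apply: walk_refl => //; case: (walk_domR w).
    split; rewrite subrr mulr0.
      exists z0, 0; split=> //; last by rewrite /r0; lra.
      by apply: walk_refl => //; left.
    apply: (@walk_le _ _ _ _ _ _ (l0 + (wt G y (us n) + (del + eps)))).
      by rewrite /r0 (wt_sym G y); lra.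
    apply: walk_trans.
      by apply: walk_sym; apply: walk_sub w => v [/noncore_Y].
    apply: walk_cons; last exact: us_walk.
      by apply: noncore_Y; apply: walk_domL wz0.
    by rewrite (adj_sym G).
  case gt: (g t) ng => [e|] // _.
  have lz0 := walk_ge0 wz; have wpos := wt_pos zt; have l20 := walk_ge0 w2.
  have wpos0 := wt_pos zx0.
  have et : exit_walk G noncore t (xs n) (l2 + wt G z0 (xs n)) by exists z0, l2.
  have [||en' re rch] := @tentacle_join n g e t _ (r0 - lz - wt G z t) _ rn gt et.
  - by split.
  - by rewrite /r0; lra.
  have ncz : noncore z by case: (walk_domR wz) => -[].
  exists z, lz, e; split=> //; first by rewrite /r0; lra.
  - by rewrite ltnW.
  - apply: exit_walk_mono (exit_walk_cons ncz zt et) => //; rewrite /r0; lra.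
  - have -> : r0 - lz = wt G z t + (r0 - lz - wt G z t) by lra.
    apply: (reaches_cons _ _ zt).
    + by move=> v [->|/go[/noncore_Y]] //; apply: noncore_Y.
    + by left.
    + by apply: reaches_mono rch => v; right.
(* The tube stands for the fresh stretch, and [W'] completes it to whole blocks. A tube vertex
   reached from [y] at length [l1] has remaining cost [r0 - l1], so it counts as lying on the
   tentacle. *)
pose W := tube G D y z l.
have WD v : W v -> D v by case=> l1 [l2 [/walk_domR]].
pose W' v := `[< exists2 t, W t & q t = q v >].
pose g' v := if g v is Some k then Some k else if W' v then Some e else None.
have gg' v k : g v = Some k -> g' v = Some k by rewrite /g' => ->.
have Wg' v : W v -> g' v = Some e.
  move=> Wv; rewrite /g'; case: (WD _ Wv) => _ ->.
  by have -> : W' v by apply/asboolP; exists v.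
have g'nc v k : g' v = Some k -> noncore v.
  rewrite /g'; case gv: (g v) => [m|]; first by case: (go _ _ gv).
  case: ifP => // /asboolP[t /WD[nct _] qt] _.
  exact: noncore_block nct.
have Wreach t l1 l2 : walk G D y t l1 -> walk G D t z l2 -> l1 + l2 <= l ->
    reaches (owned_by g' e) n e t (r0 - l1).
  move=> w1 w2 h; have wt2 := tube_walk w1 w2 h.
  have ow v : v = z \/ owned_by g e v -> owned_by g' e v.
    case=> [->|]; last exact: gg'.
    by apply: Wg'; apply: walk_domR wt2.
  have := reaches_trans (fun v gv => noncore_Y (g'nc v e gv)) (walk_sub Wg' wt2)
    (reaches_mono ow rz).
  by apply: reaches_le; lra.
have wyz := walk_self wz.
exists g', e; split=> //; last first.
  have -> : kap n = wt G (us n) y + r0 by rewrite /r0; lra.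
  apply: (reaches_cons _ _ uy).
  - by move=> v [->|/g'nc/noncore_Y].
  - by left.
  - apply: (@reaches_mono (owned_by g' e)); first by right.
    rewrite -[r0]subr0; apply: (Wreach y 0 l) => //; last by rewrite add0r.
    by apply: walk_refl => //; apply: walk_domL wz.
split.
  move=> u v quv; rewrite /g' (gq _ _ quv); case: (g v) => //.
  suff -> : W' u = W' v by [].
  by apply/asboolP/asboolP => -[t Wt qt]; exists t => //; rewrite qt.
move=> v k g'v; split; first exact: g'nc g'v.
move: g'v; rewrite /g'; case gv: (g v) => [m|].
  move=> [<-]; have [_ [j [t [h [r [ejn rje tj qt rch]]]]]] := goS.2 _ _ gv.
  exists j, t, h, r; split=> //; apply: reaches_mono rch => w; exact: gg'.
case: ifP => // /asboolP[t [l1 [l2 [w1 w2 h12]]] qt] [<-].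
exists n, t, (wt G (us n) y + l1), (r0 - l1); split=> //.
- by rewrite ele ltnS leqnn.
- by rewrite rn re.
- exists y, l1; split=> //.
  + by apply: walk_sub w1 => w [].
  + have w2' : walk G noncore t z l2 by apply: walk_sub w2 => w [].
    by apply: exit_walk_mono (exit_walk_trans w2' nz) => //; lra.
  + by rewrite /r0; lra.
- exact: Wreach w1 w2 h12.
Qed.

(** Roots are treated by increasing index, so every merge leads to an earlier root and the tolls add
    up. *)
Lemma tentacles_exist n : exists g en, owned_spec n g /\ root_spec n g en.
Proof.
elim: n => [|n [g [en [gS enS]]]].
  by exists (fun=> None), id; split.
have [rn|nrn] := boolP (root_att n); last first.
  exists g, en; split.
    case: gS => gq go; split=> // v e /go[ncv [j [t [h [r [/andP[ej jn] rje tj qt rch]]]]]].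
    by split=> //; exists j, t, h, r; split=> //; rewrite ej ltnW.
  move=> j; rewrite ltnS leq_eqVlt => /predU1P[->|]; first by rewrite (negPf nrn).
  exact: enS.
have [g' [e [gg' g'S [ele re] rch]]] := own_tentacle rn gS.
exists g', (fun j => if j == n then e else en j); split=> // j.
rewrite ltnS leq_eqVlt => /predU1P[->|jn rj]; first by rewrite eqxx.
rewrite (ltn_eqF jn); have [enj rej rchj] := enS j jn rj; split=> //.
by apply: reaches_mono rchj => v [->|/gg']; [left | right].
Qed.

(** * Bounds on the accumulated errors *)

Lemma eps_le_del : 30%:R * eps <= del.
Proof.
rewrite -(ler_pM2r del_gt0); apply: le_trans eps_small.
by rewrite ler_pM2l ?mulr_gt0 // lerDr.
Qed.

Lemma th_top : th * top <= del.
Proof.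
rewrite -(ler_pM2r del_gt0) mulrAC th_del; apply: le_trans eps_small.
have := eps_gt0; have := del_gt0; have := top_ge0; nra.
Qed.

(** The walk from [s j] over [us j] and [t] to [s e] gives [X <= 2 top + 3 del + th X] for
    [X = pos j - pos e]. As [th <= 1/10], this bounds [X], and [eps_small] then bounds [th X]. *)
Lemma join_error j e t h rho : root_att j -> root_att e -> (e <= j)%N ->
  walk G Y (us j) t h -> h + rho <= kap j ->
  walk G Y t (s e) (rho + th * (pos j - pos e) + top + del + eps) ->
  th * (pos j - pos e) <= del.
Proof.
move=> rj re ej w1 hr w2.
have [jN _ _ _ _] := root_attP rj; have [eN _ _ _ _] := root_attP re.
have := core_dist eps_gt0 del_gt0 C jN eN
  (walk_trans (walk_sym (us_walk rj)) (walk_trans w1 w2)).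
rewrite ger0_norm ?subr_ge0 ?pos_le //.
have kt := kap_le_top jN.
have X0 : 0 <= pos j - pos e by rewrite subr_ge0 pos_le.
move: X0; move: (pos j - pos e) => X X0 le.
have e0 := eps_gt0; have d0 := del_gt0; have t0 := top_ge0.
have s0 := eps_small; have ed := eps_le_del; have td := th_del.
have {le} le : X <= 2%:R * top + 3%:R * del + th * X by lra.
rewrite leNgt; apply/negP => gt.
have hX : del * (th * X) = 3%:R * eps * X by rewrite mulrA [del * th]mulrC td.
have : del * del < del * (th * X) by rewrite ltr_pM2l.
have : 3%:R * eps * X <= 3%:R * eps * (2%:R * top + 3%:R * del + th * X).
  by rewrite ler_pM2l ?mulr_gt0.
have : 30%:R * eps * (th * X) <= del * (th * X).
  by rewrite ler_pM2r //; lra.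
rewrite hX; move: s0; rewrite !mulrDr !mulrA; move: (eps * top) => A1.
have : 0 < eps * del by rewrite mulr_gt0.
have : 0 <= eps * top by rewrite mulr_ge0 // ltW.
nra.
Qed.

Lemma exit_walk_walk (D E : V -> Prop) u x l : (forall v, D v -> E v) -> E x ->
  exit_walk G D u x l -> walk G E u x l.
Proof.
move=> DE Ex [y [l' [w yx h]]]; apply: (walk_le h).
apply: walk_trans (walk_sub DE w) _; apply: walk_edge => //.
by apply: DE; apply: walk_domR w.
Qed.

(** Each step to the next core costs an extra [eps], covered by the toll on the gap. The walk stays
    in the cell of [r], hence in one cluster. *)
Lemma root_chain r i j : (i <= j)%N -> (j < N)%N ->
  (forall k, (i <= k <= j)%N -> ro k = r) ->
  walk G (fun v => exists k, [/\ (k < N)%N, ro k = r & A k v]) (s i) (s j)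
    ((1 + th) * (pos j - pos i)).
Proof.
elim: j => [|j IH].
  rewrite leqn0 => /eqP-> N0 hr; rewrite subrr mulr0; apply: walk_refl => //.
  by exists 0%N; split=> //; [apply: hr | apply: (core_start C)].
rewrite leq_eqVlt => /predU1P[->|ij] jN hr.
  rewrite subrr mulr0; apply: walk_refl => //.
  by exists j.+1; split=> //; [apply: hr; rewrite leqnn | apply: (core_start C)].
have w := IH ij (ltnW jN) (fun k hk => hr k ltac:(lia)).
have gap := th_gap (ltnSn j) jN; have e0 := eps_gt0.
apply: (@walk_le _ _ _ _ _ _ ((1 + th) * (pos j - pos i) + (pos j.+1 - pos j + eps))).
  by move: gap; rewrite !mulrDl !mulrBr; lra.
apply: walk_trans w _; apply: exit_walk_walk (core_step C jN).
  by move=> v Av; exists j; split=> //; [apply: ltnW | apply: hr; lia].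
by exists j.+1; split=> //; [apply: hr; lia | apply: (core_start C)].
Qed.

Lemma root_walk i : (i < N)%N ->
  walk G (fun v => exists k, [/\ (k < N)%N, ro k = ro i & A k v]) (s i) (s (ro i))
    ((1 + th) * `|pos i - pos (ro i)|).
Proof.
move=> iN; have [rN _ _] := ro_root i.
have [le|/ltnW le] := leqP i (ro i).
  rewrite distrC ger0_norm ?subr_ge0 ?pos_le //; apply: root_chain => // k hk.
  by apply: root_between => //; rewrite hk.
rewrite ger0_norm ?subr_ge0 ?pos_le //; apply: walk_sym; apply: root_chain => // k hk.
by apply: root_between => //; rewrite hk orbT.
Qed.

(** A founding root has the maximal value [top], so any core at positive distance does better on its
    own: founders serve only themselves. *)
Lemma founder_root i : (i < N)%N -> ~~ att (ro i) -> ro i = i.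
Proof.
move=> iN na; have [rN _ _] := ro_root i.
have := tentacle rN; rewrite (negPf na) => -[_ _ kr].
have := psi_le_kap iN; have := kap_le_top iN; rewrite /psi /cost kr.
have := normr_ge0 (pos i - pos (ro i)) => h1 h2 h3.
have /eqP : `|pos i - pos (ro i)| = 0 by lra.
by rewrite normr_eq0 subr_eq0 => /eqP /(core_pos_inj del_gt0 C iN rN).
Qed.

(** * The clusters of one level *)

Variable cl : V -> V.
Hypothesis cl_out : forall y x, Y y -> ~ Y x -> adj G y x -> ~ Y (cl x).

(** The last clause says that no exit undercuts founding by more than [7 del], the error allowance
    of one level. *)
Definition founded (S : V -> Prop) (cl' : V -> V) u :=
  [/\ S (cl' u), cl' (cl' u) = cl' u,
    walk G (fun y => S y /\ cl' y = cl' u) u (cl' u) (del + eps)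
  & forall x l, exit_walk G Y u x l -> ~ Y x -> top <= l + lam x + 7%:R * del].

Definition joined (S : V -> Prop) (cl' : V -> V) u := exists x l,
  [/\ ~ Y x, cl' u = cl x, exit_walk G (fun y => S y /\ cl' y = cl x) u x l,
    l + lam x <= top + 7%:R * del
  & forall x' l', exit_walk G Y u x' l' -> ~ Y x' ->
      l + lam x <= l' + lam x' + 7%:R * del].

(** The walk from [a] to [b] will make [S] meet every bag met by [Y]. The fixed points of [cl'] in
    [S] are the new centres, spread out along the path at positions [p]. *)
Definition level_spec (S : V -> Prop) (cl' : V -> V) (p : V -> R) :=
  [/\ forall u, S u -> Y u,
    forall u v, q u = q v -> S u -> S v /\ cl' v = cl' u,
    exists l, walk G S a b l,
    forall u, S u -> founded S cl' u \/ joined S cl' u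
  & forall u u', S u -> S u' -> cl' u = u -> cl' u' = u' -> u <> u' ->
      del < `|p u - p u'| /\ forall l, walk G Y u u' l -> `|p u - p u'| <= l + eps].

Lemma level_of_choices : exists S cl' p, level_spec S cl' p.
Proof.
have [g [en [[gq go] enS]]] := tentacles_exist N.
have e0 := eps_gt0; have d0 := del_gt0; have ed := eps_le_del.
have t0 := th_gt0; have tt := th_top.
have /choice[idx hidx] : forall v, exists i, core v -> (i < N)%N /\ A i v.
  by move=> v; have [[i iN Av]|nc] := pselect (core v); [exists i | exists 0%N].
have hro i : (i < N)%N -> (ro i < N)%N by move=> _; have [] := ro_root i.
have idxE i v : (i < N)%N -> A i v -> idx v = i.
  move=> iN Av; have [jN Av'] := hidx v (ex_intro2 _ _ i iN Av).
  exact: (core_inj C jN iN Av' Av).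
(* Cores follow their root: a founding root is a new centre, an attached root [j] uses the exit of
   [en j]. *)
pose kcl j := if att j then cl (xs (en j)) else s j.
pose cl' v := if `[< core v >] then kcl (ro (idx v))
  else if g v is Some e then cl (xs e) else v.
pose S v := core v \/ g v <> None.
have coreY v : core v -> Y v by move=> [i iN]; apply: (core_Y C).
have SY v : S v -> Y v.
  case=> [/coreY//|]; case gv: (g v) => [e|] // _.
  by have [/noncore_Y] := go _ _ gv.
have corecl i v : (i < N)%N -> A i v -> cl' v = kcl (ro i).
  move=> iN Av; rewrite /cl'; have -> : `[< core v >] by apply/asboolP; exists i.
  by rewrite (idxE i).
have owncl v e : g v = Some e -> cl' v = cl (xs e).
  move=> gv; rewrite /cl' gv; case: ifP => // /asboolP cv.
  by have [[]] := go _ _ gv.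
have ownS v e : g v = Some e -> S v by move=> gv; right; rewrite gv.
have rootatt i : (i < N)%N -> att (ro i) -> root_att (ro i).
  by move=> iN ai; rewrite /root_att hro // ai root_idem // eqxx.
have cl_xs e : root_att e -> ~ Y (cl (xs e)).
  move=> /root_attP[eN _ Au nYx cle].
  case: cle => [[ux _]|[y [l [uy [z [l' [w zx _]]] _]]]].
    exact: (cl_out (core_Y C eN Au) nYx ux).
  exact: (cl_out (noncore_Y (walk_domR w)) nYx zx).
have founderP i : (i < N)%N -> ~~ att (ro i) -> forall u, A i u ->
    cl' u = s i /\ founded S cl' u.
  move=> iN na u Au; have ri := founder_root iN na.
  have clA v : A i v -> cl' v = s i.
    by move=> Av; rewrite (corecl i) // /kcl ri -{1}ri (negPf na).
  have As := core_start C iN.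
  split; first exact: clA.
  split; rewrite ?(clA _ Au) ?(clA _ As) //.
  - by left; exists i.
  - have := core_walk C iN Au; apply: walk_sub => v Av.
    by split; [left; exists i | apply: clA].
  - move=> x l ex nYx; have := psi_exit iN Au ex nYx.
    have := tentacle (hro _ iN); rewrite (negPf na) => -[_ _ kr].
    by rewrite -psi_root // ri in kr; rewrite kr; lra.
have kcl_reach i : (i < N)%N -> att (ro i) -> let e := en (ro i) in
    root_att e /\ exists2 P, P <= del &
      reaches (fun v => v = us (ro i) \/ owned_by g e v) (ro i) e (us (ro i)) (kap (ro i))
      /\ P = th * (pos (ro i) - pos e).
  move=> iN ai e; have ra := rootatt i iN ai.
  have [ee re rch] := enS _ (hro i iN) ra; split=> //.
  exists (th * (pos (ro i) - pos e)) => //.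
  apply: (@join_error _ _ (us (ro i)) 0 (kap (ro i))) => //; last by case: rch.
    by apply: walk_refl => //; apply: walk_domL (us_walk ra).
  by rewrite add0r.
have joinedC i u : (i < N)%N -> att (ro i) -> A i u -> joined S cl' u.
  move=> iN ai Au; have ra := rootatt i iN ai.
  have [rN rr Aus _ _] := root_attP ra.
  have [re [P Ple [[rx _] PE]]] := kcl_reach i iN ai.
  set e := en (ro i) in re rx PE.
  have [_ _ _ nYx _] := root_attP re.
  have clA k v : (k < N)%N -> ro k = ro i -> A k v -> S v /\ cl' v = cl (xs e).
    move=> kN rk Av; split; first by left; exists k.
    by rewrite (corecl k) // /kcl rk ai.
  pose D v := S v /\ cl' v = cl (xs e).
  have w1 : walk G D u (s i) (del + eps).
    by apply: walk_sub (core_walk C iN Au) => v; apply: clA.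
  have w2 : walk G D (s i) (s (ro i)) ((1 + th) * `|pos i - pos (ro i)|).
    by apply: walk_sub (root_walk iN) => v [k [kN rk Av]]; apply: clA Av.
  have w3 : walk G D (s (ro i)) (us (ro i)) (del + eps).
    by apply: walk_sym; apply: walk_sub (core_walk C rN Aus) => v; apply: clA.
  have ex : exit_walk G D (us (ro i)) (xs e) (kap (ro i) + P - lam (xs e)).
    rewrite PE; apply: exit_walk_mono rx => // v [->|gv]; first exact: clA Aus.
    by split; [apply: ownS gv | apply: owncl].
  have h : th * `|pos i - pos (ro i)| <= del.
    apply: le_trans tt; rewrite ler_pM2l //.
    have := psi_le_kap iN; have := kap_le_top iN; have := kap_ge0 rN.
    by rewrite /psi /cost; lra.
  have psiE : psi i = `|pos i - pos (ro i)| + kap (ro i) by [].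
  have psit : psi i <= top := le_trans (psi_le_kap iN) (kap_le_top iN).
  have := exit_walk_trans (walk_trans (walk_trans w1 w2) w3) ex => exu.
  exists (xs e), (psi i + 4%:R * del - lam (xs e) + 2%:R * eps); split=> //.
  - by rewrite (corecl i) // /kcl ai.
  - by apply: exit_walk_mono exu => //; rewrite psiE mulrDl; lra.
  - lra.
  (* The walk built exceeds [psi i] by [4 del + 2 eps] and [psi_exit] loses [2 del + 4 eps]; with
     [30 eps <= del] the sum is below [7 del]. *)
  - move=> x' l' ex' nYx'; have := psi_exit iN Au ex' nYx'; lra.
have joinedO u e : g u = Some e -> joined S cl' u.
  move=> gu; have [ncu [j [t [h [rho [/andP[ej jN] /andP[rj re] tj qt [rx ry]]]]]]] := go _ _ gu.
  have [_ _ _ nYx _] := root_attP re.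
  have hr : h + rho <= kap j by case: tj => y [l []].
  have := join_error rj re ej (on_tentacle_walk rj tj) hr ry.
  move: (th * _) rx => P rx Ple.
  pose D v := S v /\ cl' v = cl (xs e).
  have OD v : g v = Some e -> D v by move=> gv; split; [apply: ownS gv | apply: owncl].
  have wb := block_walk qt.
  have w1 : walk G D u t eps.
    apply: walk_sym; apply: walk_sub wb => v qv; apply: OD.
    by rewrite -gu; apply: gq; rewrite qv.
  have w1Y : walk G Y t u eps.
    by apply: walk_sym; apply: walk_sub w1 => v [/SY].
  have rx' : exit_walk G D t (xs e) (rho + P - lam (xs e)).
    by apply: exit_walk_mono rx => //; apply: OD.
  exists (xs e), (eps + (rho + P - lam (xs e))); split=> //.
  - exact: owncl.
  - exact: exit_walk_trans rx'.
  - have := on_tentacle_h tj; have := kap_le_top jN.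
    by lra.
  - move=> x' l' ex' nYx'.
    have := on_tentacle_exit rj tj (exit_walk_trans w1Y ex') nYx'; lra.
exists S, cl', (fun v => pos (idx v)); split=> //.
- move=> u v quv; case=> [[i iN Au]|].
    have Av := core_block C iN quv Au.
    by split; [left; exists i | rewrite !(corecl i)].
  case gu: (g u) => [e|] // _.
  have gv : g v = Some e by rewrite -gu; apply: gq.
  by split; [apply: ownS gv | rewrite !(owncl _ e)].
- have N0 := core_N C; have cS v : core v -> S v by left.
  have w j : (j < N)%N -> exists l, walk G S (s 0%N) (s j) l.
    elim: j => [|j IH] jN.
      exists 0; apply: walk_refl => //; apply: cS; exists 0%N => //.
      exact: (core_start C).
    have [l wl] := IH (ltnW jN).
    exists (l + (pos j.+1 - pos j + eps)); apply: walk_trans wl _.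
    apply: exit_walk_walk (core_step C jN).
      by move=> v Av; apply: cS; exists j => //; apply: ltnW.
    by apply: cS; exists j.+1 => //; apply: (core_start C).
  have lN : (N.-1 < N)%N by rewrite prednK.
  have [l wl] := w _ lN; exists (l + (del + eps)).
  rewrite -(core_first C); apply: walk_trans wl _; apply: walk_sym.
  apply: walk_sub (core_walk C lN (core_last C)) => v Av.
  by apply: cS; exists N.-1.
- move=> u; case=> [[i iN Au]|].
    have [ai|nai] := boolP (att (ro i)); first by right; apply: joinedC Au.
    by left; have [] := founderP i iN nai u Au.
  by case gu: (g u) => [e|] // _; right; apply: joinedO gu.
(* Fixed points come from founding cores only: a joined vertex of [Y] is sent outside [Y], by
   [cl_xs]. *)
have fixP u : S u -> cl' u = u -> exists i, [/\ (i < N)%N, s i = u & idx u = i].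
  case=> [[i iN Au]|].
    have [ai|nai] := boolP (att (ro i)).
      have [re _] := kcl_reach i iN ai.
      rewrite (corecl i) // /kcl ai => clu; case: (cl_xs _ re).
      by rewrite clu; apply: (core_Y C iN Au).
    have [-> _] := founderP i iN nai u Au => su.
    by exists i; split=> //; apply: idxE.
  case gu: (g u) => [e|] // _; rewrite (owncl _ _ gu) => clu.
  have [ncu [j [t [h [rho [_ /andP[_ re] _ _ _]]]]]] := go _ _ gu.
  by case: (cl_xs _ re); rewrite clu; apply: noncore_Y.
move=> u u' Su Su' /(fixP _ Su)[i [iN si ->]] /(fixP _ Su')[j [jN sj ->]] uu'.
split.
  have ij : i <> j by move=> ij; apply: uu'; rewrite -si -sj ij.
  have [lt|lt|//] := ltngtP i j.
    have gap := core_pos_gap del_gt0 C lt jN.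
    by rewrite ltr0_norm; lra.
  have gap := core_pos_gap del_gt0 C lt iN.
  by rewrite gtr0_norm; lra.
by move=> l; rewrite -si -sj; apply: (core_dist eps_gt0 del_gt0 C).
Qed.

End Level.

(** * The levels *)

Lemma level_exists (R : realType) (V : finType) (G : wgraph R V) (T : eqType)
    (q : V -> T) (eps del : R) (Y : V -> Prop) (lam : V -> R) (top l : R)
    (cl : V -> V) (a b : V) :
  0 < eps -> 0 < del ->
  (forall u v, q u = q v -> walk G (fun x => q x = q u) u v eps) ->
  (forall u v, q u = q v -> Y u -> Y v) ->
  (forall x, 0 <= lam x) -> 0 <= top ->
  30%:R * eps * (top + del) <= del * del ->
  (forall y x, Y y -> ~ Y x -> adj G y x -> ~ Y (cl x)) ->
  walk G Y a b l -> exists S cl' p, level_spec G q eps del Y lam top a b cl S cl' p.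
Proof.
move=> e0 d0 bw Yb lam0 top0 small clo w.
have [p [pp <- pY geo]] := geodesic_exists e0 w.
have [N [s [pos [A C]]]] := core_chain_exists e0 d0 bw Yb pp pY geo.
have /choice[d tent] := tentacle_exists G Y e0 lam0 top0 a N A.
have /choice[ro roP] := root_exists C (fun i => (d i).1.1.1).
exact: (level_of_choices e0 d0 bw Yb lam0 top0 small C tent roP clo).
Qed.

(** * Bags as separators *)

Section Bags.
Variables (R : realType) (V : finType) (G : wgraph R V) (X : seq {set V}).
Hypothesis pdX : path_decomposition G X.

(** Let bag [t] contain the first edge. If [t <= j], continue from its second endpoint; otherwise
    [u] lies in bags [i] and [t], hence in bag [j]. *)
Lemma walk_hits_bag D a b l i j k : walk G D a b l -> (i <= j <= k)%N ->
  (k < size X)%N -> a \in nth finset.set0 X i -> b \in nth finset.set0 X k ->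
  exists2 v, v \in nth finset.set0 X j & D v.
Proof.
case: pdX => _ edges between w /andP[+ jk] kX + bk; move: a l w i.
apply: walk_rind => [l Db l0|u x l l' Du ux w IH ll] i ij ai.
  by exists b => //; apply: (between b i j k) => //; rewrite ij.
have [B BX /andP[uB xB]] := edges _ _ ux.
have [t tX tB] : exists2 t, (t < size X)%N & nth finset.set0 X t = B.
  by exists (index B X); rewrite ?index_mem ?nth_index.
have [tj|/ltnW jt] := leqP t j; first by apply: (IH t); rewrite ?tB.
by exists u => //; apply: (between u i j t); rewrite ?ij ?tB.
Qed.

(** Take [a] in the first and [b] in the last bag meeting [Z]. *)
Lemma spanning_pair (Z : {set V}) z : z \in Z -> exists a b,
  [/\ a \in Z, b \in Z & forall D l, walk G D a b l ->
     forall B u, B \in X -> u \in B -> u \in Z -> exists2 v, v \in B & D v].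
Proof.
move=> zZ; have [cover _ _] := pdX.
pose P t := (t < size X)%N && [exists v, (v \in nth finset.set0 X t) && (v \in Z)].
have PB B v : B \in X -> v \in B -> v \in Z -> P (index B X).
  move=> BX vB vZ; rewrite /P index_mem BX; apply/existsP; exists v.
  by rewrite nth_index // vB.
have exP : exists t, P t.
  by have [B BX zB] := cover z; exists (index B X); apply: PB BX zB zZ.
have Pub t : P t -> (t <= size X)%N by case/andP=> /ltnW.
case: (ex_minnP exP) => i /andP[iX /existsP[a /andP[ai aZ]]] imin.
case: (ex_maxnP exP Pub) => k /andP[kX /existsP[b /andP[bk bZ]]] kmax.
exists a, b; split=> // D l w B u BX uB uZ; have PBX := PB B u BX uB uZ.
have [|v] := walk_hits_bag (j := index B X) w _ kX ai bk.
  by rewrite imin ?kmax.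
by rewrite nth_index // => vB Dv; exists v.
Qed.

End Bags.

(** * Induction over the levels *)

Section Stages.
Variables (R : realType) (V : finType) (G : wgraph R V) (T : eqType) (q : V -> T).
Variables (eps del : R) (w : nat) (X : seq {set V}).
Hypothesis eps_gt0 : 0 < eps.
Hypothesis del_gt0 : 0 < del.
Hypothesis block_walk :
  forall u v, q u = q v -> walk G (fun x => q x = q u) u v eps.
Hypothesis pdX : path_decomposition G X.
Hypothesis w_gt0 : (0 < w)%N.
Hypothesis bag_size : forall B, B \in X -> (#|B| <= w)%N.
Hypothesis eps_small : 330%:R * w%:R * eps <= del.

Notation unit := (10%:R * del).

(* After m levels the clustered vertices are those with lev v <= m, and lev is
   m.+1 on the others; cl v is the centre of the cluster of v, lev (cl v) the
   level at which that cluster was founded, and nu v the distance label of v in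
   multiples of unit. The components of {lev >= i} are the regions processed at
   level i, and pos v is the position of a centre v along the corresponding
   near-shortest path. *)
Record stage (m : nat) (cl : V -> V) (lev nu : V -> nat) (pos : V -> R) : Prop :=
Stage {
  stage_lev : forall v, (0 < lev v <= m.+1)%N;
  stage_block : forall u v, q u = q v ->
    lev u = lev v /\ ((lev u <= m)%N -> cl u = cl v);
  stage_centre : forall v, (lev v <= m)%N ->
    [/\ cl (cl v) = cl v, (lev (cl v) <= nu v)%N & (nu v <= lev v)%N];
  stage_walk : forall v, (lev v <= m)%N ->
    walk G (fun u => (lev u <= m)%N /\ cl u = cl v) v (cl v)
      (unit * (nu v + lev v)%:R);
  stage_label : forall u x l, (lev u <= m)%N -> (lev x < lev u)%N ->
    exit_walk G (fun y => (lev u <= lev y)%N) u x l -> l <= 2%:R * del ->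
    (nu u <= nu x)%N;
  stage_packing : forall c c' l, (lev c <= m)%N -> cl c = c -> cl c' = c' ->
    lev c' = lev c -> c <> c' -> walk G (fun y => (lev c <= lev y)%N) c c' l ->
    del < `|pos c - pos c'| <= l + eps;
  stage_bag : forall v B (Z : {set V}), lev v = m.+1 -> B \in X -> Z \subset B ->
    (forall z, z \in Z -> exists l, walk G (fun y => lev y = m.+1) v z l) ->
    (#|Z| <= w - m)%N }.

Lemma stage0 : stage 0 id (fun=> 1%N) (fun=> 0%N) (fun=> 0).
Proof.
split=> // v B Z _ /bag_size Bw /subset_leq_card ZB _.
by rewrite subn0; apply: leq_trans Bw.
Qed.

(** Costs are rounded down to units. An exit of length at most [2 del] to [x] bounds the cost by
    [unit * nu x + 9 del], below the next multiple of [unit], so [n <= nu x] holds without error. *)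
Lemma label_exists (lam : V -> R) (nu : V -> nat) m Y S (cl cl' : V -> V) u :
  (forall x, lam x = unit * (nu x)%:R) ->
  founded G eps del Y lam (unit * m.+1%:R) S cl' u \/
  joined G del Y lam (unit * m.+1%:R) cl S cl' u ->
  exists n,
  [/\ (n <= m.+1)%N,
    forall x l, exit_walk G Y u x l -> ~ Y x -> l <= 2%:R * del -> (n <= nu x)%N
  & [/\ n = m.+1, S (cl' u), cl' (cl' u) = cl' u
      & walk G (fun y => S y /\ cl' y = cl' u) u (cl' u) (del + eps)] \/
    exists x l, [/\ ~ Y x, cl' u = cl x,
      exit_walk G (fun y => S y /\ cl' y = cl x) u x l, (nu x <= n)%N
      & l + unit * (nu x)%:R <= unit * n.+1%:R]].
Proof.
move=> lamE; have d0 := del_gt0.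
have unit0 : 0 < unit by rewrite mulr_gt0.
have cmp n k : unit * n%:R <= unit * k%:R + 9%:R * del -> (n <= k)%N.
  move=> h; rewrite -ltnS -(ltr_nat R) -(ltr_pM2l unit0) -[k.+1%:R]natr1 mulrDr mulr1; lra.
case=> [[Sc cc wc bc]|[x [l [nYx clx ex ltop lmin]]]].
  exists m.+1; split=> //; last by left.
  move=> x l exl nYx l2; apply: cmp; have := bc _ _ exl nYx; rewrite lamE; lra.
set val := l + lam x in ltop lmin.
have val0 : 0 <= val / unit.
  rewrite divr_ge0 ?(ltW unit0) // /val lamE addr_ge0 ?(exit_walk_ge0 ex) //.
  by rewrite mulr_ge0 // ltW.
have /andP[] := truncn_itv val0; move: (Num.truncn _) => n.
rewrite ler_pdivlMr // ltr_pdivrMr // ![_ * unit]mulrC => hn1 hn2.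
exists n; split.
- by apply: cmp; lra.
- move=> x' l' ex' nYx' l2; apply: cmp; have := lmin _ _ ex' nYx'; rewrite lamE; lra.
- right; exists x, l; split=> //; last by rewrite -lamE ltW.
  rewrite -ltnS -(ltr_nat R) -(ltr_pM2l unit0); apply: le_lt_trans hn2.
  by rewrite /val lamE lerDr (exit_walk_ge0 ex).
Qed.

Lemma eps_le : 330%:R * eps <= del.
Proof.
apply: le_trans eps_small; rewrite ler_pM2r // -[leLHS]mulr1 ler_pM2l //.
by rewrite ler1n.
Qed.

(** Every component of the unclustered part is processed by [level_exists]. The set clustered there
    meets each bag met by the component, so the unclustered part of a bag shrinks. *)
Lemma stageS m cl lev nu pos : (m < w)%N -> stage m cl lev nu pos ->
  exists cl' lev' nu' pos', stage m.+1 cl' lev' nu' pos'.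
Proof.
move=> mw [slev sblock scentre swalk slabel spack sbag].
have d0 := del_gt0; have e0 := eps_gt0.
pose U y := lev y = m.+1.
have nU y : (lev y <= m)%N -> ~ U y by rewrite /U => + e; rewrite e ltnn.
have Um y : ~ U y -> (lev y <= m)%N.
  by have /andP[_] := slev y; rewrite leq_eqVlt => /predU1P[].
pose comp v := [set u | `[< exists l, walk G U v u l >]].
have inC v u : u \in comp v <-> exists l, walk G U v u l.
  by rewrite inE; split=> /asboolP.
have compU v u : u \in comp v -> U u by move=> /inC[l /walk_domR].
have compE v u : u \in comp v -> comp u = comp v.
  move=> /inC[l wl]; apply/setP => y; apply/idP/idP => /inC[l' wl']; apply/inC.
    by exists (l + l'); apply: walk_trans wl'.
  by exists (l + l'); apply: walk_trans wl'; apply: walk_sym.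
have comp_self v : U v -> v \in comp v.
  by move=> Uv; apply/inC; exists 0; apply: walk_refl.
have walkC v u l : walk G U v u l -> walk G (fun y => y \in comp v) v u l.
  move=> wl; have := walk_self wl; apply: walk_sub => y [_ [l1 [l2 [w1 _ _]]]].
  by apply/inC; exists l1.
have exitC v x l : exit_walk G U v x l -> exit_walk G (fun y => y \in comp v) v x l.
  by case=> y [l' [wl yx h]]; exists y, l'; split=> //; apply: walkC.
pose lam x : R := unit * (nu x)%:R.
have lam0 x : 0 <= lam x by rewrite mulr_ge0 // mulr_ge0 // ltW.
have cl_done v : (lev v <= m)%N -> (lev (cl v) <= m)%N.
  move=> vm; have [_ h1 h2] := scentre _ vm.
  exact: leq_trans h1 (leq_trans h2 vm).
(* Indexing the data by the vertex set of a component lets [choice] give the same data to all its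
   vertices. *)
pose good (Z : {set V}) (d : (V -> Prop) * (V -> V) * (V -> R)) :=
  (exists2 v, U v & Z = comp v) -> exists a b,
  level_spec G q eps del (fun y => y \in Z) lam (unit * m.+1%:R) a b cl d.1.1 d.1.2 d.2
  /\ forall B u, B \in X -> u \in B -> u \in Z -> exists2 v, v \in B & d.1.1 v.
have /choice[d hd] : forall Z, exists d, good Z d.
  move=> Z; have [[v Uv Zv]|nZ] := pselect (exists2 v, U v & Z = comp v); last first.
    by exists (fun=> False, id, fun=> 0) => /nZ.
  have vZ : v \in Z by rewrite Zv comp_self.
  have [a [b [aZ bZ hab]]] := spanning_pair pdX vZ.
  have [l wab] : exists l, walk G (fun y => y \in Z) a b l.
    move: (aZ) (bZ); rewrite Zv => aC /inC[l2 w2].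
    have /inC[l1 w1] := aC.
    exists (l1 + l2); rewrite -(compE _ _ aC); apply: walkC.
    by apply: walk_trans w2; apply: walk_sym.
  have [||||S [cl' [p sp]]] := @level_exists R V G T q eps del (fun y => y \in Z) lam
      (unit * m.+1%:R) l cl a b e0 d0 block_walk _ lam0 _ _ _ wab.
  - move=> x y qxy; rewrite Zv => xv; rewrite -(compE _ _ xv); apply/inC.
    exists eps; apply: walk_sub (block_walk qxy) => z qz.
    have [lz _] := sblock _ _ qz; rewrite /U lz; exact: compU _ _ xv.
  - by rewrite mulr_ge0 // mulr_ge0 // ltW.
  (* As [m + 1 <= w], [top + del] is at most [11 w del], and [30 * 11 = 330]. *)
  - have h : m.+1%:R <= w%:R :> R by rewrite ler_nat.
    have h1 : 1 <= w%:R :> R by rewrite ler1n.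
    apply: (@le_trans _ _ (del * (330%:R * w%:R * eps))); last by rewrite ler_pM2l.
    have -> : del * (330%:R * w%:R * eps) = 30%:R * eps * (11%:R * w%:R * del) by lra.
    rewrite ler_pM2l ?mulr_gt0 //.
    have : del * m.+1%:R <= del * w%:R by rewrite ler_pM2l.
    have : del * 1 <= del * w%:R by rewrite ler_pM2l.
    lra.
  - move=> y x yZ nxZ yx; have [/cl_done|lx] := leqP (lev x) m.
      by move=> cm cZ; apply: (nU _ cm); apply: (compU v); rewrite -Zv.
    case: nxZ; rewrite Zv in yZ *; have /inC[l' wl'] := yZ; apply/inC.
    exists (l' + wt G y x); apply: walk_trans wl' _; apply: walk_edge => //.
      exact: compU _ _ yZ.
    by have /andP[_ lxm] := slev x; apply/eqP; rewrite eqn_leq lxm.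
  exists (S, cl', p) => _; exists a, b; split=> // B u BX uB uZ.
  by have [_ _ [l' wS] _ _] := sp; apply: hab wS _ _ BX uB uZ.
pose S v := (d (comp v)).1.1 v.
have specP v : U v -> good (comp v) (d (comp v)) /\ exists2 u, U u & comp v = comp u.
  by move=> Uv; split=> //; exists v.
have SU v : U v -> forall u, (d (comp v)).1.1 u -> u \in comp v.
  by move=> /specP[h /h[a [b [[SY _ _ _ _] _]]]]; apply: SY.
have SC v : U v -> forall u, (d (comp v)).1.1 u -> S u /\ comp u = comp v.
  by move=> Uv u Su; have uv := compE _ _ (SU _ Uv _ Su); rewrite /S uv.
have exlab v : exists n, U v -> S v ->
  [/\ (n <= m.+1)%N,
    forall x l, exit_walk G (fun y => y \in comp v) v x l -> x \notin comp v ->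
      l <= 2%:R * del -> (n <= nu x)%N
  & [/\ n = m.+1, (d (comp v)).1.1 ((d (comp v)).1.2 v),
      (d (comp v)).1.2 ((d (comp v)).1.2 v) = (d (comp v)).1.2 v
      & walk G (fun y => (d (comp v)).1.1 y /\ (d (comp v)).1.2 y = (d (comp v)).1.2 v)
          v ((d (comp v)).1.2 v) (del + eps)] \/
    exists x l, [/\ x \notin comp v, (d (comp v)).1.2 v = cl x,
      exit_walk G (fun y => (d (comp v)).1.1 y /\ (d (comp v)).1.2 y = cl x) v x l,
      (nu x <= n)%N & l + unit * (nu x)%:R <= unit * n.+1%:R]].
  have [Uv|nUv] := pselect (U v); last by exists 0%N.
  have [Sv|nSv] := pselect (S v); last by exists 0%N.
  have [h /h[a [b [[_ _ _ fj _] _]]]] := specP v Uv.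
  have [n [nm nl nc]] := label_exists (fun=> erefl) (fj _ Sv).
  exists n => _ _; split=> //.
    by move=> x l ex /negP nx; apply: nl.
  by case: nc => [|[x [l [/negP nx ? ? ? ?]]]]; [left | right; exists x, l].
have {exlab} /choice[nuS hnuS] := exlab.
pose done v := (lev v <= m)%N.
pose cl1 v := if done v then cl v else (d (comp v)).1.2 v.
pose lev1 v := if done v then lev v else if `[< S v >] then m.+1 else m.+2.
pose nu1 v := if done v then nu v else nuS v.
pose pos1 v := if done v then pos v else (d (comp v)).2 v.
have old v : done v -> [/\ cl1 v = cl v, lev1 v = lev v, nu1 v = nu v & pos1 v = pos v].
  by rewrite /cl1 /lev1 /nu1 /pos1 => ->.
have new v : ~~ done v -> [/\ U v, cl1 v = (d (comp v)).1.2 v, nu1 v = nuS v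
    & pos1 v = (d (comp v)).2 v].
  move=> nd; rewrite /cl1 /nu1 /pos1 (negPf nd); split=> //.
  by apply: contrapT => /Um; apply/negP.
have levS v : ~~ done v -> S v -> lev1 v = m.+1.
  by rewrite /lev1 => /negPf-> /asboolP->.
have lev1_le v : (lev1 v <= m.+1)%N -> ~~ done v -> S v.
  by move=> lv nd; move: lv; rewrite /lev1 (negPf nd); case: asboolP => //; rewrite ltnn.
have lev1_old v : (lev1 v <= m)%N -> done v.
  rewrite /lev1; case: ifP => // _; case: ifP => _; by rewrite ?ltnn // ltnNge leqnSn.
have lev1_U v : (m < lev1 v)%N -> U v.
  move=> h; have [dv|/new[]//] := boolP (done v).
  by move: h; have [_ -> _ _] := old _ dv; rewrite ltnNge; case/negP.
have Ud v : U v -> ~~ done v by move=> Uv; apply/negP => /nU.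
have lev1_dom i v : (i <= m)%N -> (i <= lev1 v)%N -> (i <= lev v)%N.
  move=> im; have [/old[_ -> _ _]//|/new[-> _ _ _] _] := boolP (done v).
  exact: leqW.
have SD v u : U v -> (d (comp v)).1.1 u ->
    [/\ ~~ done u, lev1 u = m.+1 & cl1 u = (d (comp v)).1.2 u].
  move=> Uv Su; have [Su' cu] := SC _ Uv _ Su.
  have nd : ~~ done u by apply/Ud/(compU v)/(SU _ Uv).
  by have [_ -> _ _] := new _ nd; rewrite levS // cu.
have exit_done v x l (P : V -> Prop) : U v -> x \notin comp v ->
    exit_walk G (fun y => (d (comp v)).1.1 y /\ P y) v x l -> done x.
  move=> Uv nx [y [l' [wl yx _]]]; apply: Um => Ux; case/negP: nx.
  have [Sy _] := walk_domR wl; have yC := SU _ Uv _ Sy.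
  have /inC[l2 w2] := yC; apply/inC; exists (l2 + wt G y x).
  by apply: walk_trans w2 _; apply: walk_edge => //; apply: compU yC.
exists cl1, lev1, nu1, pos1; split.
- move=> v; have [/old[_ -> _ _]|nd] := boolP (done v).
    by have /andP[-> h] := slev v; apply: leqW h.
  by rewrite /lev1 (negPf nd); case: ifP => _; rewrite /= ?leqnSn ?leqnn.
- move=> u v quv; have [luv clE] := sblock _ _ quv.
  have [du|nd] := boolP (done u).
    have dv : done v by rewrite /done -luv.
    by have [-> -> _ _] := old _ du; have [-> -> _ _] := old _ dv; split=> // _; apply: clE.
  have ndv : ~~ done v by rewrite /done -luv.
  have [Uu clu _ _] := new _ nd; have [Uv clv _ _] := new _ ndv.
  have uC : u \in comp v.
    apply/inC; exists eps; apply: walk_sym; apply: walk_sub (block_walk quv) => z qz.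
    by rewrite /U -Uu; case: (sblock _ _ qz).
  have cE := compE _ _ uC.
  have [h /h[a [b [[_ Sq _ _ _] _]]]] := specP v Uv.
  have SE : S u <-> S v.
    by rewrite /S cE; split=> [/(Sq _ _ quv)[]|/(Sq _ _ (esym quv))[]].
  split; first by rewrite /lev1 (negPf nd) (negPf ndv) (asbool_equiv_eq SE).
  move=> /lev1_le/(_ nd) Su; rewrite clu clv cE.
  by have [_ ->] : S v /\ _ := Sq _ _ quv ltac:(by rewrite -cE).
- move=> v lv; have [dv|nd] := boolP (done v).
    have [-> -> -> _] := old _ dv; have [-> _ _ _] := old _ (cl_done _ dv).
    have [h1 h2 h3] := scentre _ dv; rewrite h1; split=> //.
    by have [_ -> _ _] := old _ (cl_done _ dv).
  have Sv := lev1_le _ lv nd; have [Uv -> -> _] := new _ nd.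
  have [n1 _ [[nE Sc cc _]|[x [l [nx clx ex nn _]]]]] := hnuS v Uv Sv.
    have [_ lc clc] := SD _ _ Uv Sc.
    by rewrite clc cc lc nE (levS _ nd Sv).
  have dx := exit_done _ _ _ _ Uv nx ex.
  have [h1 h2 h3] := scentre _ dx; rewrite clx (levS _ nd Sv).
  have [-> -> _ _] := old _ (cl_done _ dx); split=> //.
  exact: leq_trans h2 nn.
- move=> v lv; have [dv|nd] := boolP (done v).
    have [clE lE nE _] := old _ dv; rewrite clE lE nE.
    apply: walk_sub (swalk _ dv) => y [dy cly].
    by have [-> -> _ _] := old _ dy; split=> //; apply: leqW.
  have Sv := lev1_le _ lv nd; have [Uv clv nuv _] := new _ nd.
  rewrite clv nuv (levS _ nd Sv).
  have [n1 _ [[nE Sc cc wc]|[x [l [nx clx ex nn hl]]]]] := hnuS v Uv Sv.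
    apply: walk_mono wc => [y [Sy cly]|].
      by have [_ -> ->] := SD _ _ Uv Sy.
    have h1 : 1 <= (nuS v + m.+1)%:R :> R by rewrite ler1n addnS.
    have : unit * 1 <= unit * (nuS v + m.+1)%:R by rewrite ler_pM2l // mulr_gt0.
    have := eps_le; lra.
  have dx := exit_done _ _ _ _ Uv nx ex.
  rewrite clx.
  have wx : walk G (fun y => (lev1 y <= m.+1)%N /\ cl1 y = cl x) x (cl x)
      (unit * (nu x + lev x)%:R).
    apply: walk_sub (swalk _ dx) => y [dy cly].
    by have [-> -> _ _] := old _ dy; split=> //; apply: leqW.
  have wv : walk G (fun y => (lev1 y <= m.+1)%N /\ cl1 y = cl x) v x l.
    case: ex => y [l' [wl yx h]]; apply: (walk_le h).
    have wl' : walk G (fun y => (lev1 y <= m.+1)%N /\ cl1 y = cl x) v y l'.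
      apply: walk_sub wl => z [Sz clz].
      by have [_ -> ->] := SD _ _ Uv Sz.
    apply: (walk_trans wl' _); apply: walk_edge => //; first exact: walk_domR wl'.
    exact: walk_domL wx.
  apply: walk_le (walk_trans wv wx).
  (* Rounding gives [l + unit * nu x <= unit * (nu v + 1)]; the lost unit is paid for by the level,
     which rises from [lev x <= m] to [m + 1]. *)
  have lxm : (lev x)%:R <= m%:R :> R by rewrite ler_nat.
  have : unit * (lev x)%:R <= unit * m%:R by rewrite ler_pM2l // mulr_gt0.
  have -> : (nuS v + m.+1)%N = ((nuS v).+1 + m)%N by lia.
  by move: hl; rewrite !natrD !mulrDr; lra.
- move=> u x l lu lxu ex l2; have [du|nd] := boolP (done u).
    have [_ luE nuE _] := old _ du; rewrite luE in lxu ex.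
    have dx : done x by apply: lev1_old; apply: ltnW (leq_trans lxu _).
    have [_ lxE nxE _] := old _ dx; rewrite lxE in lxu; rewrite nuE nxE.
    apply: slabel lxu _ l2 => //; apply: exit_walk_mono ex => // y.
    exact: lev1_dom.
  have Su := lev1_le _ lu nd; have [Uu clu nuu _] := new _ nd.
  rewrite (levS _ nd Su) in lxu ex.
  have dx : done x by apply: lev1_old.
  have [_ _ -> _] := old _ dx; rewrite nuu.
  have [_ h _] := hnuS u Uu Su; apply: (h x l) => //.
    by apply: exitC; apply: exit_walk_mono ex => // y /lev1_U.
  by apply/negP => /compU; apply: nU.
- move=> c c' l lc clc clc' lE cc' wcc.
  have [dc|nd] := boolP (done c).
    have [clE lcE _ pE] := old _ dc.
    have dc' : done c' by apply: lev1_old; rewrite lE lcE.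
    have [clE' lcE' _ pE'] := old _ dc'.
    rewrite pE pE'; apply: spack => //; rewrite -?clE -?clE' -?lcE -?lcE' //.
    by apply: walk_sub wcc => y; apply: lev1_dom; rewrite lcE.
  have Sc := lev1_le _ lc nd; have [Uc ccE _ pE] := new _ nd.
  have lcE := levS _ nd Sc; rewrite lcE in lE wcc.
  have nd' : ~~ done c'.
    by apply/negP => dc'; have := lE; have [_ -> _ _] := old _ dc'; apply: nU.
  have Sc' : S c' by apply: lev1_le nd'; rewrite lE.
  have [Uc' ccE' _ pE'] := new _ nd'.
  have wC : walk G (fun y => y \in comp c) c c' l.
    by apply: walkC; apply: walk_sub wcc => y /lev1_U.
  have cE := compE _ _ (walk_domR wC).
  have [h /h[a [b [[_ _ _ _ pk] _]]]] := specP c Uc.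
  rewrite /S cE in Sc'; rewrite ccE in clc; rewrite ccE' cE in clc'.
  have [h1 h2] := pk c c' Sc Sc' clc clc' cc'.
  by rewrite pE pE' cE h1 h2.
- move=> v B Z lv BX ZB hZ.
  have [->|[z zZ]] := set_0Vmem Z; first by rewrite cards0.
  have ndv : ~~ done v by apply/negP => /old[_ lE _ _]; have /andP[_] := slev v; rewrite -lE lv ltnn.
  have [Uv _ _ _] := new _ ndv.
  have hZU y : y \in Z -> exists l, walk G U v y l.
    by move=> /hZ[l wl]; exists l; apply: walk_sub wl => t lt; apply: lev1_U; rewrite lt.
  have [h /h[a [b [_ hit]]]] := specP v Uv.
  have [u uB Su] := hit B z BX (fintype.subsetP ZB _ zZ) ((inC v z).2 (hZU _ zZ)).
  have [_ lu _] := SD _ _ Uv Su.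
  have uZ : u \notin Z.
    by apply/negP => /hZ[l /walk_domR]; rewrite lu => /eqP; rewrite eqn_leq ltnn andbF.
  (* The vertex [u] has just been clustered but was unclustered before, so the old bound applies to
     [Z] enlarged by [u]. *)
  have : (#|u |: Z| <= w - m)%N.
    apply: (sbag v B) => //.
      by apply/fintype.subsetP => y; rewrite !inE => /predU1P[->//|/(fintype.subsetP ZB)].
    by move=> y; rewrite !inE => /predU1P[->|/hZU//]; apply/inC; apply: SU.
  by rewrite cardsU1 uZ; lia.
Qed.

(** After [w] levels the bound [w - m] is zero, so no bag contains an unclustered vertex. *)
Lemma stages : exists cl lev nu pos, stage w cl lev nu pos /\
  forall v, (lev v <= w)%N.
Proof.
have H m : (m <= w)%N -> exists cl lev nu pos, stage m cl lev nu pos.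
  elim: m => [|m IH] mw; first by exists id, (fun=> 1%N), (fun=> 0%N), (fun=> 0); apply: stage0.
  by have [cl [lev [nu [pos]]]] := IH (ltnW mw); apply: stageS.
have [cl [lev [nu [pos st]]]] := H w (leqnn w).
exists cl, lev, nu, pos; split=> // v; rewrite leqNgt; apply/negP => lv.
have [cover _ _] := pdX; have [B BX vB] := cover v.
have lvE : lev v = w.+1 by have /andP[_ h] := stage_lev st v; apply/eqP; rewrite eqn_leq h.
have := stage_bag st lvE BX (Z := [set v]); rewrite cards1 subnn finset.sub1set vB.
suff h : forall z, z \in [set v] -> exists l, walk G (fun y => lev y = w.+1) v z l.
  by move=> /(_ erefl h).
by move=> z; rewrite inE => /eqP->; exists 0; apply: walk_refl.
Qed.

End Stages.

(** * Counting the clusters meeting a ball *)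

Section Clustering.
Variables (R : realType) (V : finType) (G : wgraph R V) (T : eqType) (q : V -> T).
Variables (eps del : R) (w : nat) (X : seq {set V}).
Hypothesis eps_gt0 : 0 < eps.
Hypothesis del_gt0 : 0 < del.
Hypothesis w_gt0 : (0 < w)%N.
Hypothesis eps_small : 330%:R * w%:R * eps <= del.
Variables (cl : V -> V) (lev nu : V -> nat) (pos : V -> R).
Hypothesis st : stage G q eps del w X w cl lev nu pos.
Hypothesis lev_le : forall v, (lev v <= w)%N.

Notation unit := (10%:R * del).

Lemma centre_idem v : cl (cl v) = cl v.
Proof. by case: (stage_centre st (lev_le v)). Qed.

Lemma centre_lev v : (lev (cl v) <= nu v <= lev v)%N.
Proof. by case: (stage_centre st (lev_le v)) => _ -> ->. Qed.

Lemma centre_walk v :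
  walk G (fun u => cl u = cl v) v (cl v) (20%:R * w%:R * del).
Proof.
have d0 := del_gt0.
apply: walk_mono (stage_walk st (lev_le v)) => [u []//|].
have -> : 20%:R * w%:R * del = unit * (2%:R * w%:R) by lra.
rewrite ler_pM2l ?mulr_gt0 // -natrM ler_nat.
have /andP[_] := centre_lev v; have := lev_le v; lia.
Qed.

Definition near v u := walk G (fun=> True) v u del.

Lemma near_walk v u : near v u -> walk G (near v) v u del.
Proof.
move=> vu; have := walk_self vu; apply: walk_sub => z [_ [l1 [l2 [w1 w2 h]]]].
by apply: walk_le w1; have := walk_ge0 w2; lra.
Qed.

(* Once the ball around v has been hit at level lev z, every vertex of the
   ball gets a label at most lev z, and so belongs to an old cluster. *)
Lemma near_label v z : near v z -> (forall u, near v u -> (lev z <= lev u)%N) ->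
  forall u, near v u -> (nu u <= lev z)%N.
Proof.
move=> vz zmin u.
elim/ltn_ind: {u}(lev u) {-2}u (erefl (lev u)) => n IH u lu vu.
have [le|gt] := leqP (lev u) (lev z).
  by have /andP[_ h] := centre_lev u; apply: leq_trans h le.
have wuz := walk_trans (walk_sym (near_walk vu)) (near_walk vz).
have nz : ~ (lev u <= lev z)%N by rewrite leqNgt gt.
have [x [l1 [l2 [ex /negP nx wx h]]]] :=
  walk_exit (E := fun y => (lev u <= lev y)%N) wuz (leqnn _) nz.
rewrite -ltnNge in nx.
apply: (@leq_trans (nu x)).
  apply: (stage_label st (lev_le u) nx (l := l1)).
    by apply: exit_walk_mono ex => // y [].
  by have := walk_ge0 wx; lra.
by apply: (IH (lev x)) (walk_domL wx) => //; rewrite -lu.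
Qed.

(** The level restriction is the one in [stage_packing]. It holds in the ball by [near_label], and
    in the cluster because no vertex has a lower level than its centre. *)
Lemma near_centre v u z : near v z -> (forall u, near v u -> (lev z <= lev u)%N) ->
  near v u ->
  walk G (fun y => (lev (cl u) <= lev y)%N) v (cl u) (del + 20%:R * w%:R * del).
Proof.
move=> vz zmin vu; have nuz := near_label vz zmin vu.
have /andP[cn _] := centre_lev u.
apply: (@walk_trans _ _ _ _ _ u).
  apply: walk_sub (near_walk vu) => y /zmin; apply: leq_trans.
  exact: leq_trans cn nuz.
apply: walk_sub (centre_walk u) => y <-.
by have /andP[h1 h2] := centre_lev y; apply: leq_trans h1 h2.
Qed.

(** Centres of one level have positions more than [del] apart in a window of width [O(w del)]. So a
    centre is determined by its level and rounded position, and
    [(w + 1) * (87 w + 1) <= 176 w ^ 2]. *)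
Lemma near_card v (Z : {set V}) :
  (forall c, c \in Z -> exists2 u, near v u & cl u = c) -> (#|Z| <= 176 * w ^ 2)%N.
Proof.
move=> ZP; have [e0 d0] := (eps_gt0, del_gt0).
pose P n := `[< exists2 u, near v u & lev u = n >].
have vv : near v v by apply: walk_refl => //; apply: ltW.
have exP : exists n, P n by exists (lev v); apply/asboolP; exists v.
case: (ex_minnP exP) => j /asboolP[z vz lz] jmin.
have zmin u : near v u -> (lev z <= lev u)%N.
  by move=> vu; rewrite lz; apply: jmin; apply/asboolP; exists u.
have Zwalk c : c \in Z ->
    walk G (fun y => (lev c <= lev y)%N) v c (del + 20%:R * w%:R * del).
  by move=> /ZP[u vu <-]; apply: near_centre vz zmin vu.
have Zfix c : c \in Z -> cl c = c by move=> /ZP[u _ <-]; apply: centre_idem.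
have sep c c' : c \in Z -> c' \in Z -> lev c = lev c' -> c <> c' ->
    del < `|pos c - pos c'| <= 43%:R * w%:R * del.
  move=> cZ c'Z lcc cc'; have w1 := Zwalk _ cZ; have w2 := Zwalk _ c'Z.
  rewrite -lcc in w2.
  have /andP[-> h] := stage_packing st (lev_le c) (Zfix _ cZ) (Zfix _ c'Z)
    (esym lcc) cc' (walk_trans (walk_sym w1) w2).
  apply: (le_trans h).
  (* Here [2 (1 + 20 w) del + eps <= 43 w del]. *)
  have h1 : 1 <= w%:R :> R by rewrite ler1n.
  have : del * 1 <= del * w%:R by rewrite ler_pM2l.
  have : eps * 1 <= eps * w%:R by rewrite ler_pM2l.
  have := eps_small; lra.
have /choice[ref refP] : forall i, exists c0, forall c, c \in Z -> lev c = i ->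
    c0 \in Z /\ lev c0 = i.
  move=> i; have [[c cZ ci]|n] := pselect (exists2 c, c \in Z & lev c = i).
    by exists c.
  by exists v => c cZ ci; case: n; exists c.
(* Positions are taken relative to a reference centre of the same level; the shift makes them
   nonnegative for truncation. *)
pose off c := (pos c - pos (ref (lev c))) / del + 43%:R * w%:R.
have w0 : 0 <= 43%:R * w%:R :> R by rewrite mulr_ge0.
have offP c : c \in Z -> 0 <= off c <= 86%:R * w%:R.
  move=> cZ; have [rZ lr] := refP _ _ cZ erefl.
  have : `|(pos c - pos (ref (lev c))) / del| <= 43%:R * w%:R.
    have [->|/eqP cr] := eqVneq c (ref (lev c)).
      by rewrite lr subrr mul0r normr0.
    have /andP[_] := sep _ _ cZ rZ (esym lr) cr.
    by rewrite normrM (@gtr0_norm _ del^-1) ?invr_gt0 // ler_pdivrMr.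
  by rewrite /off ler_norml => /andP[h1 h2]; apply/andP; split; lra.
have idxP c : c \in Z -> (Num.truncn (off c) < (87 * w).+1)%N.
  move=> cZ; have /andP[h1 h2] := offP _ cZ.
  have /andP[h3 _] := truncn_itv h1.
  rewrite ltnS -(ler_nat R) natrM; apply: (le_trans h3); apply: (le_trans h2).
  by rewrite ler_wpM2r // ler_nat.
pose F c : 'I_w.+1 * 'I_(87 * w).+1 := (inord (lev c), inord (Num.truncn (off c))).
have Finj : {in Z &, injective F}.
  move=> c c' cZ c'Z [] /(congr1 (@nat_of_ord _)); rewrite !inordK ?ltnS ?lev_le // => lcc.
  move=> /(congr1 (@nat_of_ord _)); rewrite !inordK ?idxP // => tcc.
  apply: contrapT => cc'; have /andP[+ _] := sep _ _ cZ c'Z lcc cc'.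
  have /andP[o1 _] := offP _ cZ; have /andP[o2 _] := offP _ c'Z.
  have := truncn_itv o1; have := truncn_itv o2; rewrite -tcc.
  rewrite /off lcc -[(Num.truncn _).+1%:R]natr1.
  move: (Num.truncn _)%:R => t /andP[a1 a2] /andP[b1 b2].
  apply/negP; rewrite -leNgt.
  have -> : pos c - pos c' = del * ((pos c - pos (ref (lev c'))) / del
      - (pos c' - pos (ref (lev c'))) / del).
    by rewrite -mulrBl mulrC divfK ?gt_eqF //; lra.
  rewrite normrM gtr0_norm // -[leRHS]mulr1 ler_pM2l // ler_norml.
  by apply/andP; split; lra.
have := leq_card_in F _ Finj; rewrite card_prod !card_ord.
rewrite expnS expn1; nia.
Qed.

End Clustering.

Lemma clustering_step (R : realType) (V : finType) (G : wgraph R V) (T : eqType)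
    (q : V -> T) (eps del : R) (w : nat) (X : seq {set V}) :
  0 < eps -> (forall u v, q u = q v -> walk G (fun x => q x = q u) u v eps) ->
  path_decomposition G X -> (0 < w)%N -> (forall B, B \in X -> (#|B| <= w)%N) ->
  330%:R * w%:R * eps <= del ->
  exists cl : V -> V,
  [/\ forall u v, q u = q v -> cl u = cl v,
    forall u v, cl u = cl v -> walk G (fun x => cl x = cl u) u v (40%:R * w%:R * del)
  & forall v (Z : {set V}),
      (forall c, c \in Z -> exists2 u, walk G (fun=> True) v u del & cl u = c) ->
      (#|Z| <= 176 * w ^ 2)%N].
Proof.
move=> e0 bw pdX w0 Xw small.
have d0 : 0 < del.
  by apply: lt_le_trans small; rewrite !mulr_gt0 // ltr0n.
have [cl [lev [nu [pos [st lw]]]]] := stages e0 d0 bw pdX w0 Xw small.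
exists cl; split.
- by move=> u v /(stage_block st)[_]; apply.
- move=> u v cuv; have -> : 40%:R * w%:R * del = 20%:R * w%:R * del + 20%:R * w%:R * del.
    by lra.
  have wu := centre_walk e0 d0 w0 small st lw u; have wv := walk_sym (centre_walk e0 d0 w0 small st lw v).
  by rewrite -cuv in wv; apply: walk_trans wu wv.
- exact: (near_card e0 d0 w0 small st lw).
Qed.

(** * The hierarchy *)

Section Distances.
Variables (R : realType) (V : finType) (G : wgraph R V).

(** The infimum in [dist] directly yields a path only for a strictly larger bound. *)
Lemma ball_walk v u (r r' : R) : r < r' -> u \in Defs.ball G v r ->
  walk G (fun=> True) v u r'.
Proof.
rewrite inE => rr' du; apply: walk_sym.
have : (dist G u v < r'%:E)%E by apply: le_lt_trans du _; rewrite lte_fin.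
move=> /ereal_inf_lt[_ [p [pp pl] <-]]; rewrite lte_fin => /ltW pw.
by exists p.
Qed.

Lemma dist_induced_le (C : {set V}) l (x y : {x | x \in C}) :
  walk G (fun z => z \in C) (val x) (val y) l -> (dist (induced G C) x y <= l%:E)%E.
Proof.
move=> wxy.
suff H : forall u l', walk G (fun z => z \in C) u (val y) l' ->
    forall x : {x | x \in C}, val x = u ->
    walk (induced G C) (fun=> True) x y l'.
  have [p [pp pl _ pw]] := H _ _ wxy x erefl.
  apply: (@le_trans _ _ (walk_length (induced G C) x p)%:E); last by rewrite lee_fin.
  by apply: ereal_inf_lbound; exists p.
apply: walk_rind => {x wxy l} [l _ l0 x /val_inj->|u z l l' Cu uz wz IH ll x xu].
  exact: walk_refl.
have Cz : z \in C := walk_domL wz.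
have := IH (exist _ z Cz) erefl; move=> w.
apply: (walk_le ll); rewrite -xu.
by apply: (walk_cons (G := induced G C)) w => //=; rewrite xu.
Qed.

Lemma diameter_induced_le (C : {set V}) l :
  (forall x y, x \in C -> y \in C -> walk G (fun z => z \in C) x y l) ->
  (diameter (induced G C) <= l%:E)%E.
Proof.
move=> h; apply: ge_ereal_sup => _ [[x y] _ <-] /=.
by apply: dist_induced_le; apply: h; apply: valP.
Qed.

End Distances.

(** * Partitions into fibres *)

Section Fibres.
Variables (R : realType) (V : finType) (G : wgraph R V) (f : V -> V).

Definition fibres : {set {set V}} := preim_partition f [set: V].

Lemma fibresP C : reflect (exists v, C = [set u | f u == f v]) (C \in fibres).
Proof.
apply: (iffP imsetP) => [[v _ ->]|[v ->]]; exists v => //;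
  by apply/setP => u; rewrite !inE eq_sym.
Qed.

(** A cluster meeting the ball is the fibre of a value of [f] on the ball, so it suffices to count
    values. *)
Lemma fibres_sparse (Delta alpha r : R) tau :
  0 < alpha -> Delta / alpha < r ->
  (forall u v, f u = f v -> walk G (fun x => f x = f u) u v Delta) ->
  (forall v (Z : {set V}),
      (forall c, c \in Z -> exists2 u, walk G (fun=> True) v u r & f u = c) ->
      (#|Z| <= tau)%N) ->
  strong_sparse_partition G Delta alpha tau fibres.
Proof.
move=> a0 Dr fw fc; split=> //; first exact: preim_partitionP.
  move=> C /fibresP[v ->]; apply: diameter_induced_le => x y.
  rewrite !inE => /eqP xv /eqP yv.
  have := fw x y; rewrite xv yv => /(_ erefl).
  by apply: walk_sub => z; rewrite inE => ->.
move=> v; pose Z := [set f u | u in Defs.ball G v (Delta / alpha)].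
apply: (@leq_trans #|[set [set u | f u == c] | c in Z]|).
  apply: subset_leq_card; apply/fintype.subsetP => C; rewrite inE => /andP[/fibresP[u ->]].
  case/set0Pn => x; rewrite inE => /andP[]; rewrite inE => /eqP xu xb.
  by rewrite -xu; apply: imset_f; apply: imset_f.
apply: leq_trans (leq_imset_card _ _) _; apply: (fc v) => c /imsetP[u ub ->].
by exists u => //; apply: ball_walk ub.
Qed.

End Fibres.

Lemma fibres_coarsens (V : finType) (f g : V -> V) :
  (forall u v, f u = f v -> g u = g v) -> coarsens (fibres f) (fibres g).
Proof.
move=> fg U /fibresP[v ->]; exists [set u | g u == g v].
  by apply/fibresP; exists v.
by apply/fintype.subsetP => u; rewrite !inE => /eqP /fg ->.
Qed.

Lemma fibres_id (V : finType) : fibres (@id V) = [set [set v] | v : V].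
Proof.
apply/setP => C; apply/fibresP/imsetP => [[v ->]|[v _ ->]]; exists v => //;
  by apply/setP => u; rewrite !inE.
Qed.

(** * Pathwidth and the choice of constants *)

Lemma pathwidth_decomposition (R : realType) (V : finType) (G : wgraph R V) :
  exists2 X, path_decomposition G X &
    forall B, B \in X -> (#|B| <= (pathwidth G).+1)%N.
Proof.
rewrite /pathwidth; case: ex_minnP => m /asboolP[X pdX wX] _; exists X => // B BX.
have : (#|B|.-1 <= width X)%N.
  exact: leq_bigmax_seq.
by rewrite wX; lia.
Qed.

(** Some edge exists and lies in a bag. Positivity is what gives [pw + 1 <= 2 pw]. *)
Lemma pathwidth_gt0 (R : realType) (V : finType) (G : wgraph R V) :
  (2 <= #|V|)%N -> connected_graph G -> (0 < pathwidth G)%N.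
Proof.
move=> V2 Gc; have [X [_ edges _] Xw] := pathwidth_decomposition G.
have [u [v [uv]]] : exists u v, u != v /\ connect (adj G) u v.
  have /card_gt1P[u [v [_ _ uv]]] : (1 < #|[set: V]|)%N by rewrite cardsT.
  by exists u, v; split.
case/connectP=> -[|x p] /=; first by move=> _ vu; rewrite vu eqxx in uv.
case/andP=> ux _ _; have [B BX /andP[uB xB]] := edges _ _ ux.
have : (#|[set u; x]| <= #|B|)%N.
  by apply/subset_leq_card/fintype.subsetP => y; rewrite !inE => /orP[]/eqP->.
rewrite cards2; have -> : u != x by apply/eqP => e; rewrite e adj_irr in ux.
by have := Xw _ BX; lia.
Qed.

Lemma uniform_walk_bound (R : realType) (V : finType) (G : wgraph R V) :
  connected_graph G -> exists l, forall u v, walk G (fun=> True) u v l.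
Proof.
move=> Gc.
have /choice[f fP] : forall uv : V * V, exists l, walk G (fun=> True) uv.1 uv.2 l.
  move=> [u v]; have /connectP[p pp pl] := Gc u v.
  by exists (walk_length G u p), p; split.
exists (\sum_uv f uv) => u v; apply: walk_le (fP (u, v)).
rewrite (bigD1 (u, v)) //= lerDl; apply: sumr_ge0 => uv _; exact: walk_ge0 (fP uv).
Qed.

Theorem theorem6p3 (R : realType) :
  exists K : R,
    forall (V : finType) (G : wgraph R V),
      (2 <= #|V|)%N ->
      connected_graph G ->
      (forall u v : V, u != v -> (1 <= dist G u v)%E) ->
      (exists u v : V, u != v /\ dist G u v = 1%E) ->
      exists (alpha gamma : R) (tau k : nat) (C : nat -> {set {set V}}),
        [/\ alpha <= K * (pathwidth G)%:R,
            tau%:R <= K * (pathwidth G)%:R ^+ 2,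
            gamma <= K * (pathwidth G)%:R ^+ 2
          & sparse_hierarchy G gamma alpha tau k C].
Proof.
(* [52800 = 4 * 13200], since [w ^ 2 <= 4 pw ^ 2]. *)
exists 52800%:R => V G V2 Gc dmin _.
have pw0 := pathwidth_gt0 V2 Gc.
have [X pdX] := pathwidth_decomposition G.
set pw := pathwidth G in pw0 *; set w := pw.+1 => Xw.
have w0 : (0 < w)%N by [].
have w1 : 1 <= w%:R :> R by rewrite ler1n.
have pw1 : 1 <= pw%:R :> R by rewrite ler1n.
have wpw : w%:R = pw%:R + 1 :> R by rewrite natr1.
(* [13200 = 40 * 330]: with [eps = gamma ^+ n] and [del = rad n] the new diameter [40 w del] is
   [gamma ^+ n.+1]. Dividing it by [alpha] gives half of [rad n]. *)
pose gamma : R := 13200%:R * w%:R ^+ 2.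
pose alpha : R := 80%:R * w%:R.
have alpha0 : 0 < alpha by rewrite /alpha; lra.
have gamma2 : 2%:R <= gamma.
  by rewrite /gamma expr2; have := ler_pM ler01 ler01 w1 w1; rewrite mulr1; lra.
have gamma0 n : 0 < gamma ^+ n by rewrite exprn_gt0 //; lra.
pose good n (f : V -> V) := forall u v, f u = f v ->
  walk G (fun x => f x = f u) u v (gamma ^+ n).
pose rad n : R := 330%:R * w%:R * gamma ^+ n.
pose next n (f f' : V -> V) := [/\ forall u v, f u = f v -> f' u = f' v, good n.+1 f'
  & forall v (Z : {set V}),
      (forall c, c \in Z -> exists2 u, walk G (fun=> True) v u (rad n) & f' u = c) ->
      (#|Z| <= 176 * w ^ 2)%N].
have /choice[nx nxP] : forall nf : nat * (V -> V), exists f',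
    good nf.1 nf.2 -> next nf.1 nf.2 f'.
  move=> [n f]; have [gf|ng] := pselect (good n f); last by exists f.
  have [f' [h1 h2 h3]] := clustering_step (gamma0 n) gf pdX w0 Xw (lexx (rad n)).
  exists f' => _; split=> // u v /h2; apply: walk_le.
  by rewrite /rad exprS /gamma expr2; lra.
pose fix q n : V -> V := if n is n'.+1 then nx (n', q n') else id.
have qgood n : good n (q n).
  elim: n => [u v /= ->|n IH]; last by case: (nxP (n, q n) IH).
  by apply: walk_refl => //; rewrite expr0.
have qnext n : next n (q n) (q n.+1) := nxP (n, q n) (qgood n).
have [l lP] := uniform_walk_bound Gc.
(* The successor makes [k] positive, so that level [0] is not replaced by the trivial partition. *)
pose k := (Num.bound `|l|).+1.
have lk : l <= gamma ^+ k.
  have b0 : (Num.bound `|l|)%:R <= k%:R :> R by rewrite ler_nat leqnSn.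
  have kk : k%:R <= 2%:R ^+ k :> R by rewrite -natrX ler_nat ltnW // ltn_expl.
  have gk : 2%:R ^+ k <= gamma ^+ k by rewrite lerXn2r // nnegrE; lra.
  apply: le_trans gk; apply: le_trans kk; apply: le_trans b0.
  by apply: le_trans (ler_norm l) _; apply/ltW/archi_boundP.
(* Level [k] is set to the trivial partition, which is admissible because [gamma ^+ k] bounds all
   distances. *)
exists alpha, gamma, (176 * w ^ 2)%N, k,
  (fun i => if i == k then [set [set: V]] else fibres (q i)); split.
- by rewrite /alpha wpw; lra.
- rewrite natrM natrX wpw expr2; have := ler_pM ler01 ler01 pw1 pw1.
  rewrite mulr1 expr2; nra.
- by rewrite /gamma wpw !expr2; nra.
split.
- by rewrite -fibres_id.
- by rewrite eqxx.
- move=> i ik.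
  have [->|nik] := eqVneq i k.
    split=> //.
    + apply/and3P; split.
      * by rewrite /finset.cover big_set1.
      * by apply/finset.trivIsetP => A B; rewrite !inE => /eqP-> /eqP->; rewrite eqxx.
      * rewrite inE eq_sym; apply/set0Pn.
        have /card_gt0P[v _] : (0 < #|V|)%N by apply: ltnW.
        by exists v.
    + move=> C; rewrite inE => /eqP->; apply: diameter_induced_le => x y _ _.
      by apply: walk_mono (lP x y) => // z _; rewrite inE.
    + move=> v; apply: leq_trans (subset_leq_card (_ : _ \subset [set [set: V]])) _.
        by apply/fintype.subsetP => C /finset.setIdP[].
      by rewrite cards1; nia.
  case: i ik nik => [|i] ik nik; last first.
    have [_ g h] := qnext i.
    apply: (fibres_sparse (r := rad i)) => //.
    rewrite ltr_pdivrMr // /rad exprS /alpha /gamma expr2.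
    have := gamma0 i; move: (gamma ^+ i) => e e0.
    have : 0 < w%:R * w%:R * e by rewrite !mulr_gt0 //; lra.
    lra.
  (* At level [0] the radius [1 / alpha] is below [1 / 2], less than the minimum distance, so a ball
     is a single vertex. *)
  apply: (fibres_sparse (r := 2%:R^-1)) => //.
    by rewrite expr0 ltr_pdivrMr // /alpha; lra.
    exact: (qgood 0%N).
  move=> v Z hZ; apply: (@leq_trans #|[set v]|); last by rewrite cards1; nia.
  apply: subset_leq_card; apply/fintype.subsetP => c /hZ[u vu /= <-].
  rewrite inE; apply: contraT => uv.
  case: vu => p [pp pl _ pw'].
  have := dmin v u; rewrite eq_sym => /(_ uv).
  have : (dist G v u <= (walk_length G v p)%:E)%E by apply: ereal_inf_lbound; exists p.
  by move=> /[swap] /le_trans h /h; rewrite lee_fin; lra.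
move=> i ik; rewrite (ltn_eqF ik).
have [_|nik] := eqVneq i.+1 k; last first.
  by apply: fibres_coarsens; case: (qnext i).
by move=> U _; exists [set: V]; rewrite ?inE // finset.subsetT.
Qed.
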